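(* Let $n\ge 2$, $0\le\gamma<3$, let $\Omega\subset\mathbb{R}^n$ be a bounded domain and let $\phi\in C(\partial\Omega)$ be a given nonnegative function. Then there exists a nonnegative function $u\in C(\overline{\Omega})$ satisfying, in the viscosity sense, $$\mathcal{L}^{\gamma}_\infty u=0\ \text{ in }\Omega,\qquad u=\phi\ \text{ on }\partial\Omega.$$ Moreover, such a solution is unique.
   Context: The infinity Laplacian is $\Delta_\infty u:=\sum_{i,j}\partial_i u\,\partial_{ij}u\,\partial_j u=(Du)^T D^2u\,Du$. Write $v^+=\max(v,0)$ and $\mathcal{L}^{\gamma}_\infty v:=\Delta_\infty v-(v^+)^\gamma$; for $\gamma=0$ the term $(v^+)^0$ is read as $1$ where $v>0$ and $0$ where $v\le 0$. A continuous function $u:\Omega\to\mathbb{R}$ is a viscosity subsolution of $\mathcal{L}^{\gamma}_\infty u=0$ in $\Omega$ (written $\mathcal{L}^\gamma_\infty u\ge 0$) if whenever $\varphi\in C^2$ and $u-\varphi$ has a local maximum at $Y\in\Omega$, then $\Delta_\infty\varphi(Y)-(u(Y)^+)^\gamma\ge 0$; it is a viscosity supersolution (written $\mathcal{L}^\gamma_\infty u\le 0$) if whenever $\varphi\in C^2$ and $\varphi-u$ has a local maximum at $Y\in\Omega$, then $\Delta_\infty\varphi(Y)-(u(Y)^+)^\gamma\le 0$. A viscosity solution is both. The boundary condition is attained pointwise by the continuous function $u$ on $\overline\Omega$. *)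

(* Defs.v *)
From HB Require Import structures.
From mathcomp Require Import all_boot all_order all_algebra.
From mathcomp Require Import all_classical all_reals all_analysis.

Set Implicit Arguments.
Unset Strict Implicit.
Unset Printing Implicit Defensive.

Import Order.TTheory GRing.Theory Num.Theory.
Import numFieldNormedType.Exports.

Local Open Scope classical_set_scope.
Local Open Scope ring_scope.

(* Points of R^n are row vectors. The library norm on 'rV[R]_n is the sup norm;
   below it only serves to define the topology and boundedness, for which it is
   equivalent to the Euclidean norm. Functions on a set A are represented by
   total functions of which only the values on A are relevant. *)

Definition bounded_domain (R : realType) (n : nat) (Omega : set 'rV[R]_n) :=
  [/\ Omega !=set0, open Omega, connected Omega & bounded_set Omega].

Definition boundary (T : topologicalType) (A : set T) : set T :=
  closure A `\` interior A.

Definition partial (R : realType) (n : nat) (i : 'I_n) (f : 'rV[R]_n -> R) :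
    'rV[R]_n -> R :=
  fun x => 'D_(delta_mx 0 i) f x.

(* C^2 on an open set: all partial derivatives of order 1 and 2 exist and are
   continuous. Continuity of f itself follows, so it is not required. *)
Definition C2_on (R : realType) (n : nat) (A : set 'rV[R]_n)
    (f : 'rV[R]_n -> R) :=
  forall x, A x -> forall i,
    [/\ derivable f x (delta_mx 0 i), {for x, continuous (partial i f)} &
        forall j, derivable (partial i f) x (delta_mx 0 j) /\
                  {for x, continuous (partial j (partial i f))}].

Definition infinity_laplacian (R : realType) (n : nat) (f : 'rV[R]_n -> R)
    (x : 'rV[R]_n) : R :=
  \sum_(i < n) \sum_(j < n)
    partial i f x * partial i (partial j f) x * partial j f x.

(* The term (v^+)^gamma. The case gamma = 0 is separated because the library
   has 0 `^ 0 = 1, whereas (v^+)^0 must be 0 where v <= 0. *)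
Definition absorption (R : realType) (gamma v : R) : R :=
  if gamma == 0 then ((0 < v)%R)%:R else (Num.max v 0) `^ gamma.

Definition local_max (R : realType) (n : nat) (f : 'rV[R]_n -> R)
    (Y : 'rV[R]_n) :=
  \forall x \near Y, f x <= f Y.

Definition viscosity_subsolution (R : realType) (n : nat) (gamma : R)
    (Omega : set 'rV[R]_n) (u : 'rV[R]_n -> R) :=
  {within Omega, continuous u} /\
  forall (phi : 'rV[R]_n -> R) (Y : 'rV[R]_n),
    C2_on Omega phi -> Omega Y -> local_max (fun x => u x - phi x) Y ->
    0 <= infinity_laplacian phi Y - absorption gamma (u Y).

Definition viscosity_supersolution (R : realType) (n : nat) (gamma : R)
    (Omega : set 'rV[R]_n) (u : 'rV[R]_n -> R) :=
  {within Omega, continuous u} /\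
  forall (phi : 'rV[R]_n -> R) (Y : 'rV[R]_n),
    C2_on Omega phi -> Omega Y -> local_max (fun x => phi x - u x) Y ->
    infinity_laplacian phi Y - absorption gamma (u Y) <= 0.

Definition viscosity_solution (R : realType) (n : nat) (gamma : R)
    (Omega : set 'rV[R]_n) (u : 'rV[R]_n -> R) :=
  viscosity_subsolution gamma Omega u /\ viscosity_supersolution gamma Omega u.

Definition dirichlet_solution (R : realType) (n : nat) (gamma : R)
    (Omega : set 'rV[R]_n) (phi u : 'rV[R]_n -> R) :=
  [/\ {within closure Omega, continuous u},
      forall x, closure Omega x -> 0 <= u x,
      viscosity_solution gamma Omega u &
      forall x, boundary Omega x -> u x = phi x].

(* Main.v *)
Require Import Defs.
From HB Require Import structures.
From mathcomp Require Import all_boot all_order all_algebra.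
From mathcomp Require Import all_classical all_reals all_analysis.
From mathcomp Require Import ring lra.
Import Order.TTheory GRing.Theory Num.Theory.
Import numFieldNormedType.Exports.
Set Implicit Arguments.
Unset Strict Implicit.
Unset Printing Implicit Defensive.
Local Open Scope classical_set_scope.
Local Open Scope ring_scope.

(* Uniqueness. If u is a solution and lam > 1, then w = lam u is a strict subsolution where it is
   positive, because gamma < 3. Let w(y) - v(z) be maximal among pairs at Euclidean distance at most
   2e, attained at (y0, z0) with midpoint x0. Comparing w and -v on the ball of radius 2e around x0
   with radial solutions of Delta_oo g = b, resp. -a, where 0 < a < b, bounds the increments of w
   and v over the inner radius e, and maximality of (y0, z0) makes these bounds incompatible. This
   replaces the theorem on sums for semicontinuous functions.
   Existence. Perron's method over nonnegative continuous subsolutions. Comparison with the radial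
   functions a r - b r^2 makes the family locally equi-Lipschitz and also provides barriers at
   every boundary point, so the supremum is continuous and attains phi. For gamma = 0 the absorption
   is discontinuous at 0, and the supersolution property at zeros of u needs a separate
   argument: a test function P touching u from below at a zero is traded for P / 2 + K P ^ 2. *)

(** The infinity Laplacian of [g (|y - z|)] is [g' ^ 2 * g'']; when this is constant, the cube of
    the slope is linear in the radius. Hence the incompatibility of the radial bounds is elementary:
    the cubes of the two slopes grow at rates 3 a < 3 b, so their difference is strictly monotone,
    whereas maximality of the pair forces it to move the other way between the inner and the outer
    half of the radius. Test functions must be C2 on all of the domain, and |y - z| is not C2 at z.
    Radial tests are therefore polynomials in |y - z| ^ 2, matched to [g] at one radius up to an
    arbitrarily small excess of second derivative, which strict inequalities between constants
    absorb. The strictness comes from homogeneity: the operator has degree 3 and the absorption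
    degree [gamma], so scaling by [lam] gains a factor [lam ^ (3 - gamma)]. For [gamma = 0] any bump
    at a zero of u, however small, switches the absorption on at full size 1. The quadratic in P
    overcomes this: a positive infinity Laplacian forces DP to be nonzero, and the second derivative
    of the quadratic multiplies |DP| ^ 4. *)

(** * Euclidean norm and its compatibility with the library topology *)

Section Euclid.
Variables (R : realType) (n : nat).
Implicit Types x y z : 'rV[R]_n.

(* The library norm on 'rV[R]_n is the sup norm; en is the Euclidean norm. *)
Definition sqn x : R := \sum_i x 0 i ^+ 2.
Definition en x : R := Num.sqrt (sqn x).

Lemma sqn_ge0 x : 0 <= sqn x.
Proof. by apply: sumr_ge0 => i _; exact: sqr_ge0. Qed.

Lemma en_ge0 x : 0 <= en x. Proof. exact: sqrtr_ge0. Qed.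

Lemma en_sqr x : en x ^+ 2 = sqn x.
Proof. by rewrite sqr_sqrtr// sqn_ge0. Qed.

Lemma en0 : en 0 = 0.
Proof. by rewrite /en /sqn big1 ?sqrtr0// => i _; rewrite mxE expr0n. Qed.

Lemma enN x : en (- x) = en x.
Proof. by congr Num.sqrt; apply: eq_bigr => i _; rewrite mxE sqrrN. Qed.

Lemma enB x y : en (x - y) = en (y - x).
Proof. by rewrite -enN opprB. Qed.

Lemma enZ (t : R) x : en (t *: x) = `|t| * en x.
Proof.
rewrite /en -sqrtr_sqr -sqrtrM ?sqr_ge0//; congr Num.sqrt.
by rewrite /sqn mulr_sumr; apply: eq_bigr => i _; rewrite mxE exprMn.
Qed.

Lemma coord_le_en x i : `|x 0 i| <= en x.
Proof.
rewrite -sqrtr_sqr ler_wsqrtr// /sqn (bigD1 i)//= lerDl.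
by apply: sumr_ge0 => j _; exact: sqr_ge0.
Qed.

Lemma en_eq0 x : en x = 0 -> x = 0.
Proof.
move=> x0; apply/rowP => i; rewrite mxE; apply/eqP.
by rewrite -normr_le0 -x0 coord_le_en.
Qed.

Lemma cauchy_schwarz x y : \sum_i x 0 i * y 0 i <= en x * en y.
Proof.
have [/en_eq0 ->|x0] := eqVneq (en x) 0.
  by rewrite en0 mul0r big1// => i _; rewrite mxE mul0r.
have [/en_eq0 ->|y0] := eqVneq (en y) 0.
  by rewrite en0 mulr0 big1// => i _; rewrite mxE mulr0.
have X : 0 < en x by rewrite lt_def x0 en_ge0.
have Y : 0 < en y by rewrite lt_def y0 en_ge0.
have : 0 <= \sum_i (en y * x 0 i - en x * y 0 i) ^+ 2.
  by apply: sumr_ge0 => i _; exact: sqr_ge0.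
have -> : \sum_i (en y * x 0 i - en x * y 0 i) ^+ 2 =
    en y ^+ 2 * sqn x - 2 * (en x * en y) * (\sum_i x 0 i * y 0 i) +
    en x ^+ 2 * sqn y.
  rewrite /sqn !mulr_sumr -sumrB -big_split/=; apply: eq_bigr => i _; ring.
rewrite -!en_sqr => H.
have XY : 0 < 2 * (en x * en y) by rewrite mulr_gt0// mulr_gt0.
rewrite -(ler_pM2l XY); lra.
Qed.

Lemma enD x y : en (x + y) <= en x + en y.
Proof.
rewrite -[leRHS]ger0_norm ?addr_ge0 ?en_ge0// -sqrtr_sqr ler_wsqrtr//.
have -> : sqn (x + y) = sqn x + 2 * (\sum_i x 0 i * y 0 i) + sqn y.
  rewrite /sqn mulr_sumr -!big_split/=; apply: eq_bigr => i _; rewrite mxE; ring.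
rewrite sqrrD -!en_sqr lerD2r lerD2l -[in leRHS]mulr_natl ler_pM2l//.
exact: cauchy_schwarz.
Qed.

Lemma en_triangle y x z : en (x - z) <= en (x - y) + en (y - z).
Proof. by rewrite -[x - z](subrKA y) enD. Qed.

Lemma mxnorm_le_en x : `|x| <= en x.
Proof.
rewrite [leLHS]/Num.norm/= mx_normrE; apply/bigmax_leP; split; first exact: en_ge0.
by case=> i j _ /=; rewrite (ord1 i) coord_le_en.
Qed.

Lemma coord_le_mxnorm x i : `|x 0 i| <= `|x|.
Proof.
rewrite [leRHS]/Num.norm/= mx_normrE.
by apply/bigmax_geP; right => /=; exists (0, i).
Qed.

Lemma en_le_mxnorm x : en x <= n%:R * `|x|.
Proof.
rewrite -[leRHS]ger0_norm ?mulr_ge0// -sqrtr_sqr ler_wsqrtr//.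
apply: (@le_trans _ _ (\sum_(i < n) `|x| ^+ 2)).
  by apply: ler_sum => i _; rewrite -[leLHS]real_normK ?num_real// ler_sqr ?nnegrE// coord_le_mxnorm.
rewrite sumr_const card_ord exprMn -[leLHS]mulr_natl ler_wpM2r ?sqr_ge0//.
by rewrite -natrX ler_nat; case: (n) => // k; rewrite -[X in (X <= _)%N]expn1 leq_pexp2l.
Qed.

Lemma near_enP x (P : set 'rV[R]_n) :
  (\forall y \near x, P y) <->
  exists2 r : R, 0 < r & forall y, en (y - x) < r -> P y.
Proof.
split.
  move/nbhs_normP => [r /= r0 rP]; exists r => // y yr; apply: rP => /=.
  by rewrite /= distrC (le_lt_trans (mxnorm_le_en _)).
(* [n.+1] rather than [n] keeps the divisor nonzero in dimension 0. *)
case=> r r0 rP; apply/nbhs_normP; exists (r / n.+1%:R) => /=.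
  by rewrite divr_gt0.
move=> y /=; rewrite distrC ltr_pdivlMr// mulrC => yr.
apply: rP; apply: (le_lt_trans (en_le_mxnorm _)); apply: le_lt_trans yr.
by rewrite ler_wpM2r// ler_nat.
Qed.

Lemma continuous_enP x (f : 'rV[R]_n -> R) : {for x, continuous f} <->
  forall e : R, 0 < e ->
    exists2 r : R, 0 < r & forall y, en (y - x) < r -> `|f y - f x| < e.
Proof.
split=> [fx e e0|H].
  by apply/near_enP; move/cvgrPdist_lt: fx => /(_ _ e0); apply: filterS => y; rewrite distrC.
apply/(@cvgrPdist_lt _ _ _ (nbhs x)) => e e0; apply/near_enP; have [r r0 rP] := H e e0.
by exists r => // y /rP; rewrite distrC.
Qed.

Lemma within_continuous_enP (A : set 'rV[R]_n) (f : 'rV[R]_n -> R) :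
  {within A, continuous f} <-> forall x, A x -> forall e : R, 0 < e ->
    exists2 r : R, 0 < r & forall y, A y -> en (y - x) < r -> `|f y - f x| < e.
Proof.
split=> [/subspace_continuousP fA x Ax e e0|H].
  have /cvgrPdist_lt /(_ _ e0) := fA x Ax.
  rewrite near_withinE => /near_enP[r r0 rP].
  by exists r => // y Ay yr; rewrite distrC; apply: rP.
apply/subspace_continuousP => x Ax; apply/cvgrPdist_lt => e e0.
rewrite near_withinE; apply/near_enP; have [r r0 rP] := H x Ax e e0.
by exists r => // y yr Ay; rewrite distrC; apply: rP.
Qed.

Lemma within_continuous_at (A : set 'rV[R]_n) (f : 'rV[R]_n -> R) x :
  open A -> {within A, continuous f} -> A x -> {for x, continuous f}.
Proof.
move=> oA; rewrite continuous_open_subspace// => fA Ax.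
by apply: fA; rewrite inE.
Qed.

Lemma open_enP (A : set 'rV[R]_n) x : open A -> A x ->
  exists2 r : R, 0 < r & forall y, en (y - x) < r -> A y.
Proof. by move=> oA Ax; apply/near_enP; exact: open_nbhs_nbhs. Qed.

Lemma en_lip x y : `|en x - en y| <= en (x - y).
Proof.
rewrite ler_norml lerBrDr lerBlDr.
have := enD (y - x) x; have := enD (x - y) y; rewrite !subrK (enB y x).
by move=> ? ?; apply/andP; split; lra.
Qed.

Lemma continuous_en_sub x : continuous (fun y => en (y - x)).
Proof.
move=> y; apply/continuous_enP => e e0; exists e => // z ze.
by apply: le_lt_trans ze; rewrite (le_trans (en_lip _ _))// opprB addrA subrK.
Qed.

Lemma compact_en_ball x (r : R) : compact [set y | en (y - x) <= r].
Proof.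
apply: bounded_closed_compact.
  exists (`|x| + r); split; first exact: num_real.
  move=> M Mr y /= yr; apply: le_trans (ltW Mr).
  rewrite -[y](subrK x) (le_trans (ler_normD _ _))// addrC lerD2l.
  exact: le_trans (mxnorm_le_en _) yr.
have -> : [set y | en (y - x) <= r] = (fun y => en (y - x)) @^-1` [set t | t <= r] by [].
apply: closed_comp => [y _|]; last exact: closed_le.
exact: continuous_en_sub.
Qed.

Lemma compact_max (K : set 'rV[R]_n) (f : 'rV[R]_n -> R) : K !=set0 ->
  compact K -> {within K, continuous f} ->
  exists2 c, K c & forall y, K y -> f y <= f c.
Proof.
move=> K0 cK fK; have [c] := compact_EVT_max K0 cK fK.
by rewrite inE => Kc H; exists c => // y Ky; apply: H; rewrite inE.
Qed.

End Euclid.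

(** * First-order calculus from continuous partial derivatives *)

Section Calculus.
Variables (R : realType) (n : nat).
Implicit Types (x y v : 'rV[R]_n) (f g : 'rV[R]_n -> R) (A : set 'rV[R]_n).

Local Notation e_ i := (delta_mx 0 i : 'rV[R]_n).

Lemma line_quotientE f x v t :
  (fun h : R => h^-1 *: (((fun s => f (x + s *: v)) \o shift t) (h *: (1 : R)) - f (x + t *: v))) =
  (fun h : R => h^-1 *: ((f \o shift (x + t *: v)) (h *: v) - f (x + t *: v))).
Proof.
apply/funext => h /=; congr (_ *: (f _ - _)).
by rewrite [h *: 1]mulr1 scalerDl addrCA.
Qed.

Lemma is_derive_line f x v t d : is_derive (x + t *: v) v f d <->
  is_derive t (1 : R) (fun s => f (x + s *: v)) d.
Proof.
have E := line_quotientE f x v t.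
split=> -[D V]; split.
- by rewrite /derivable E.
- by rewrite /derive E.
- by rewrite /derivable -E.
- by rewrite /derive -E.
Qed.

Lemma is_derive_quadratic_line f x v (a b : R) :
  (forall s : R, f (x + s *: v) = f x + s * a + s ^+ 2 * b) -> is_derive x v f a.
Proof.
move=> H; rewrite -[x]addr0 -(scale0r v); apply/is_derive_line.
have -> : (fun s => f (x + s *: v)) = cst (f x) + (a *: id) + b *: (id ^+ 2).
  apply/funext => s; rewrite H; rewrite /cst /= ![in RHS]fctE /GRing.scale/=; ring.
have D := is_deriveD (is_deriveD (is_derive_cst (f x) (0 : R) (1 : R))
  (is_deriveZ a (is_derive_id (0 : R) (1 : R))))
  (is_deriveZ b (is_deriveX 2 (is_derive_id (0 : R) (1 : R)))).
by apply: (is_derive_eq D); rewrite /GRing.scale/=; ring.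
Qed.

Lemma mvt_bound (F dF : R -> R) (c e t : R) :
  (forall s, `|s| <= `|t| -> is_derive s (1 : R) F (dF s)) ->
  (forall s, `|s| <= `|t| -> `|dF s - c| <= e) ->
  `|F t - F 0 - t * c| <= e * `|t|.
Proof.
move=> dFP dFe.
have [t0|t0|->] := ltgtP t 0; last by rewrite subrr mul0r subr0 normr0 mulr0.
- have H s : s \in `[t, 0] -> `|s| <= `|t|.
    by rewrite in_itv/= => /andP[? ?]; rewrite (ltr0_norm t0) ler0_norm// lerN2.
  have [c0 c0P E] : exists2 c0, c0 \in `]t, 0[ & F 0 - F t = dF c0 * (0 - t).
    apply: MVT => // [s sI|]; first by apply: dFP; apply: H; exact: subset_itv_oo_cc.
    by apply: derivable_within_continuous => s sI; have [] := dFP s (H s sI).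
  have -> : F t - F 0 - t * c = (dF c0 - c) * t by lra.
  by rewrite normrM ler_wpM2r// dFe// H//; exact: subset_itv_oo_cc.
- have H s : s \in `[0, t] -> `|s| <= `|t|.
    by rewrite in_itv/= => /andP[? ?]; rewrite (gtr0_norm t0) ger0_norm.
  have [c0 c0P E] : exists2 c0, c0 \in `]0, t[ & F t - F 0 = dF c0 * (t - 0).
    apply: MVT => // [s sI|]; first by apply: dFP; apply: H; exact: subset_itv_oo_cc.
    by apply: derivable_within_continuous => s sI; have [] := dFP s (H s sI).
  have -> : F t - F 0 - t * c = (dF c0 - c) * t by lra.
  by rewrite normrM ler_wpM2r// dFe// H//; exact: subset_itv_oo_cc.
Qed.

Lemma ler_en (a b : 'rV[R]_n) : (forall i, `|a 0 i| <= `|b 0 i|) -> en a <= en b.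
Proof.
move=> ab; rewrite ler_wsqrtr// ler_sum// => i _.
by rewrite -(real_normK (num_real (a 0 i))) -(real_normK (num_real (b 0 i))) ler_sqr ?nnegrE.
Qed.

Section C1.
Variables (f : 'rV[R]_n -> R) (x : 'rV[R]_n).
Hypothesis f_der : \forall y \near x, forall i, derivable f y (e_ i).
Hypothesis f_cont : forall i, {for x, continuous (partial i f)}.

(** Walking from x to y one coordinate at a time, the mean value theorem controls each step by a
    single partial derivative. This is the bridge from the partial derivatives in [C2_on] to
    directional derivatives and continuity. *)
Lemma C1_expand (e : R) : 0 < e -> exists2 d : R, 0 < d & forall y, en (y - x) < d ->
  `|f y - f x - \sum_i (y - x) 0 i * partial i f x| <= e * \sum_i `|(y - x) 0 i|.
Proof.
move=> e0.
have : \forall y \near x, (forall i, derivable f y (e_ i)) /\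
    (forall i, `|partial i f y - partial i f x| <= e).
  suff H i : \forall y \near x, `|partial i f y - partial i f x| <= e.
    by apply: filterI f_der _; exact: filter_forall H.
  apply/near_enP.
  have /continuous_enP /(_ e e0)[r r0 rP] := @f_cont i.
  by exists r => // y /rP /ltW.
move/near_enP => [d d0 dP]; exists d => // y yd.
(* [z k] has the first k coordinates of y and the others of x; no coordinate is further from x than
   that of y, so the path stays in the ball. *)
pose z k : 'rV[R]_n := x + \row_i (if (i < k)%N then (y - x) 0 i else 0).
have zS (k : 'I_n) : z k.+1 = z k + (y - x) 0 k *: e_ k.
  rewrite /z -addrA; congr (_ + _); apply/rowP => i; rewrite !mxE eqxx/=.
  have [->|ik] := eqVneq i k; first by rewrite ltnn ltnSn mulr1 add0r.
  by rewrite ltnS leq_eqVlt -[X in X || _]/(i == k) (negPf ik) mulr0 addr0.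
have z0 : z 0%N = x.
  by rewrite /z -[RHS]addr0; congr (_ + _); apply/rowP => i; rewrite !mxE.
have zn : z n = y.
  rewrite /z -[RHS](subrKC x); congr (_ + _); apply/rowP => i.
  by rewrite !mxE ltn_ord.
have -> : f y - f x = \sum_(k < n) (f (z k.+1) - f (z k)).
  by rewrite -(big_mkord xpredT (fun k => f (z k.+1) - f (z k))) telescope_sumr// zn z0.
rewrite -sumrB mulr_sumr; apply: le_trans (ler_norm_sum _ _ _) _.
apply: ler_sum => k _.
have near_z s : `|s| <= `|(y - x) 0 k| -> en (z k + s *: e_ k - x) < d.
  move=> sk; apply: le_lt_trans yd; apply: ler_en => i.
  rewrite /z addrAC [x + _]addrC addrK !mxE eqxx/=.
  have [->|ik] := eqVneq i k.
    by rewrite ltnn mulr1 add0r; move: sk; rewrite !mxE.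
  by rewrite mulr0 addr0; case: ifP; rewrite ?normr0.
rewrite zS.
have := @mvt_bound (fun s => f (z k + s *: e_ k)) (fun s => partial k f (z k + s *: e_ k)) (partial k f x) e ((y - x) 0 k).
rewrite scale0r addr0; apply.
- by move=> s /near_z /dP[H _]; apply/is_derive_line; apply: derivableP; exact: H.
- by move=> s /near_z /dP[_ H]; exact: H.
Qed.

Lemma C1_is_derive v : is_derive x v f (\sum_i v 0 i * partial i f x).
Proof.
set L := \sum_i _.
have H : (fun h : R => h^-1 *: ((f \o shift x) (h *: v) - f x)) @ 0^' --> L.
  apply/cvgrPdist_lt => e e0.
  pose S := \sum_i `|v 0 i|.
  have S0 : 0 <= S by apply: sumr_ge0.
  have e1 : 0 < e / (S + 1) by rewrite divr_gt0// ltr_wpDl.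
  have [d d0 dP] := C1_expand e1.
  have d1 : 0 < d / (en v + 1) by rewrite divr_gt0// ltr_wpDl// en_ge0.
  near=> h.
  have h0 : h != 0 by near: h; exact: nbhs_dnbhs_neq.
  have hd : `|h| < d / (en v + 1) by near: h; apply: dnbhs0_lt.
  have := dP (h *: v + x); rewrite addrK enZ => /(_ _)/wrap[].
    move: hd; rewrite ltr_pdivlMr ?ltr_wpDl ?en_ge0//; apply: le_lt_trans.
    by rewrite ler_wpM2l// lerDl.
  have -> : \sum_i (h *: v) 0 i * partial i f x = h * L.
    by rewrite mulr_sumr; apply: eq_bigr => i _; rewrite mxE mulrA.
  have -> : \sum_i `|(h *: v) 0 i| = `|h| * S.
    by rewrite mulr_sumr; apply: eq_bigr => i _; rewrite mxE normrM.
  move=> B; rewrite distrC /=.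
  have -> : h^-1 *: (f (h *: v + x) - f x) - L = h^-1 * (f (h *: v + x) - f x - h * L).
    by rewrite /GRing.scale/= !mulrBr mulKf//.
  rewrite normrM normfV ltr_pdivrMl ?normr_gt0//.
  apply: le_lt_trans B _; rewrite mulrCA ltr_pM2l ?normr_gt0//.
  by rewrite mulrAC ltr_pdivrMr ?ltr_wpDl// ltr_pM2l// ltrDl.
split; first by apply/cvg_ex; exists L.
exact: cvg_lim.
Unshelve. all: by end_near. Qed.

Lemma C1_continuous : {for x, continuous f}.
Proof.
apply/continuous_enP => e e0.
have [d d0 dP] := C1_expand ltr01.
pose M := \sum_i (`|partial i f x| + 1).
have M0 : 0 <= M by apply: sumr_ge0 => i _; rewrite addr_ge0.
exists (Num.min d (e / (M + 1))).
  by rewrite lt_min d0 divr_gt0// ltr_wpDl.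
move=> y; rewrite lt_min => /andP[yd ye].
have {}dP := dP y yd.
have : `|f y - f x| <= en (y - x) * M.
  have -> : f y - f x = (f y - f x - \sum_i (y - x) 0 i * partial i f x) + \sum_i (y - x) 0 i * partial i f x by ring.
  apply: le_trans (ler_normD _ _) _.
  apply: le_trans (lerD dP (ler_norm_sum _ _ _)) _.
  rewrite mul1r -big_split/= mulr_sumr; apply: ler_sum => i _.
  rewrite normrM -{1}[`|(y - x) 0 i|]mulr1 -mulrDr [1 + _]addrC.
  by apply: ler_wpM2r; rewrite ?addr_ge0// coord_le_en.
move/le_lt_trans; apply.
move: ye; rewrite ltr_pdivlMr ?ltr_wpDl//; apply: le_lt_trans.
by rewrite ler_wpM2l ?en_ge0// lerDl.
Qed.
End C1.
End Calculus.

(** * Explicit first and second derivatives of test functions *)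

Section Jets.
Variables (R : realType) (n : nat).
Implicit Types (x y z v : 'rV[R]_n) (f g : 'rV[R]_n -> R) (A : set 'rV[R]_n).

Local Notation e_ i := (delta_mx 0 i : 'rV[R]_n).

(** Carries closed formulas for the derivatives, so that composites are computed without unfolding
    limits. [X i j] differentiates in direction i and then j, so [infinity_laplacian] meets it as
    [X j i]; symmetry of the Hessian is never invoked. *)
Definition jet2 A f (p : 'I_n -> 'rV[R]_n -> R) (X : 'I_n -> 'I_n -> 'rV[R]_n -> R) :=
  forall x, A x -> forall i, [/\ is_derive x (e_ i) f (p i x),
    {for x, continuous (p i)} &
    forall j, is_derive x (e_ j) (p i) (X i j x) /\ {for x, continuous (X i j)}].

Lemma near_eq_continuous f g x : (\forall y \near x, f y = g y) ->
  {for x, continuous f} -> {for x, continuous g}.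
Proof.
move=> fg fx; apply/continuous_enP => e e0.
have /continuous_enP /(_ e e0) /near_enP fe := fx.
have fgx : f x = g x by exact: nbhs_singleton fg.
apply/near_enP; apply: filterS2 fg fe => y.
by rewrite fgx => ->.
Qed.

Lemma continuous_at_cst (c : R) x : {for x, continuous (fun _ : 'rV[R]_n => c)}.
Proof. by apply/continuous_enP => e e0; exists 1 => // y _; rewrite subrr normr0. Qed.

Lemma continuous_atD f g x : {for x, continuous f} -> {for x, continuous g} ->
  {for x, continuous (fun y => f y + g y)}.
Proof. by move=> fx gx; exact: (continuousD fx gx). Qed.

Lemma continuous_atM f g x : {for x, continuous f} -> {for x, continuous g} ->
  {for x, continuous (fun y => f y * g y)}.
Proof. by move=> fx gx; exact: (continuousM fx gx). Qed.

Lemma jet2_partial A f p X x i : jet2 A f p X -> A x -> partial i f x = p i x.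
Proof. by move=> J /J /(_ i)[[_ E] _ _]. Qed.

Lemma jet2_near A f p X x i : open A -> jet2 A f p X -> A x ->
  \forall y \near x, p i y = partial i f y.
Proof.
move=> oA J Ax; have : nbhs x A by exact: open_nbhs_nbhs.
by apply: filterS => y Ay; rewrite (jet2_partial _ J).
Qed.

Lemma jet2_partial2 A f p X x i j : open A -> jet2 A f p X -> A x ->
  partial j (partial i f) x = X i j x.
Proof.
move=> oA J Ax; have [_ _ /(_ j)[[_ <-] _]] := J x Ax i.
by apply/esym/near_eq_derive; exact: (jet2_near i oA J Ax).
Qed.

Lemma jet2_C2 A f p X : open A -> jet2 A f p X -> C2_on A f.
Proof.
move=> oA J x Ax i; have [[d _] pc D] := J x Ax i; split; first exact: d.
  exact: near_eq_continuous (jet2_near i oA J Ax) pc.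
move=> j; have [[d2 _] Xc] := D j; split.
  exact: near_eq_derivable (jet2_near i oA J Ax) d2.
apply: near_eq_continuous Xc.
have : nbhs x A by exact: open_nbhs_nbhs.
by apply: filterS => y Ay; rewrite (jet2_partial2 _ _ oA J Ay).
Qed.

Lemma C2_jet2 A f : C2_on A f ->
  jet2 A f (fun i => partial i f) (fun i j => partial j (partial i f)).
Proof.
move=> C x Ax i; have [d c H] := C x Ax i.
split; [exact: derivableP d|exact: c|move=> j].
by have [d2 c2] := H j; split; [exact: derivableP d2|exact: c2].
Qed.

Lemma jet2_laplacian A f p X x : open A -> jet2 A f p X -> A x ->
  infinity_laplacian f x = \sum_i \sum_j p i x * X j i x * p j x.
Proof.
move=> oA J Ax; apply: eq_bigr => i _; apply: eq_bigr => j _.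
by rewrite !(jet2_partial _ J Ax) (jet2_partial2 _ _ oA J Ax).
Qed.

Lemma jet2_is_derive A f p X x v : open A -> jet2 A f p X -> A x ->
  is_derive x v f (\sum_i v 0 i * p i x).
Proof.
move=> oA J Ax; have C := jet2_C2 oA J.
under eq_bigr do rewrite -(jet2_partial _ J Ax).
apply: C1_is_derive => [|i]; last by have [] := C x Ax i.
have : nbhs x A by exact: open_nbhs_nbhs.
by apply: filterS => y Ay i; have [] := C y Ay i.
Qed.

Lemma jet2_is_derive2 A f p X x v i : open A -> jet2 A f p X -> A x ->
  is_derive x v (p i) (\sum_j v 0 j * X i j x).
Proof.
move=> oA J Ax.
have E j : partial j (p i) x = X i j x by have [_ _ /(_ j)[[_ E] _]] := J x Ax i.
under eq_bigr do rewrite -E.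
have nA : nbhs x A by exact: open_nbhs_nbhs.
apply: C1_is_derive => [|j].
  by apply: filterS nA => y Ay j; have [_ _ /(_ j)[[]]] := J y Ay i.
have [_ _ /(_ j)[_]] := J x Ax i; apply: near_eq_continuous.
by apply: filterS nA => y Ay; have [_ _ /(_ j)[[_ E'] _]] := J y Ay i.
Qed.

Lemma jet2_continuous A f p X x : open A -> jet2 A f p X -> A x ->
  {for x, continuous f}.
Proof.
move=> oA J Ax; have C := jet2_C2 oA J.
apply: C1_continuous => [|i]; last by have [] := C x Ax i.
have : nbhs x A by exact: open_nbhs_nbhs.
by apply: filterS => y Ay i; have [] := C y Ay i.
Qed.

Lemma C2_continuous A f x : open A -> C2_on A f -> A x -> {for x, continuous f}.
Proof. by move=> oA /C2_jet2 J Ax; exact: jet2_continuous J Ax. Qed.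

Lemma continuous_sum (I : Type) (r : seq I) (F : I -> 'rV[R]_n -> R) x :
  (forall i, {for x, continuous (F i)}) ->
  {for x, continuous (fun y => \sum_(i <- r) F i y)}.
Proof.
move=> H; elim: r => [|i r IH].
  have -> : (fun y => \sum_(i <- [::]) F i y) = (fun=> 0).
    by apply/funext => y; rewrite big_nil.
  exact: continuous_at_cst.
have -> : (fun y => \sum_(j <- i :: r) F j y) = (fun y => F i y + \sum_(j <- r) F j y).
  by apply/funext => y; rewrite big_cons.
by apply: continuous_atD; [exact: H|exact: IH].
Qed.

Lemma continuous_laplacian A f x : C2_on A f -> A x ->
  {for x, continuous (infinity_laplacian f)}.
Proof.
move=> C Ax; apply: continuous_sum => i; apply: continuous_sum => j.
have [_ ci _] := C x Ax i; have [_ cj /(_ i)[_ cji]] := C x Ax j.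
by apply: continuous_atM => //; exact: continuous_atM.
Qed.

Lemma jet2_add A f p X g q Y : jet2 A f p X -> jet2 A g q Y ->
  jet2 A (fun x => f x + g x) (fun i x => p i x + q i x)
    (fun i j x => X i j x + Y i j x).
Proof.
move=> Jf Jg x Ax i.
have [df cf hf] := Jf x Ax i; have [dg cg hg] := Jg x Ax i; split.
- exact: is_deriveD.
- exact: continuous_atD.
- move=> j; have [df2 cf2] := hf j; have [dg2 cg2] := hg j; split.
    exact: is_deriveD.
  exact: continuous_atD.
Qed.

Lemma is_derive_cmul (c : R) f x v d : is_derive x v f d ->
  is_derive x v (fun y => c * f y) (c * d).
Proof. exact: is_deriveZ. Qed.

Lemma is_derive_cadd (c : R) f x v d : is_derive x v f d ->
  is_derive x v (fun y => c + f y) d.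
Proof.
move=> fd; rewrite -[d]add0r.
exact: (@is_deriveD _ _ _ (cst c) f x v 0 d (is_derive_cst c x v) fd).
Qed.

Lemma is_derive_mul f g x v df dg : is_derive x v f df -> is_derive x v g dg ->
  is_derive x v (fun y => f y * g y) (df * g x + f x * dg).
Proof.
move=> fd gd; have [D V] := is_deriveM fd gd; split; first exact: D.
by rewrite V /GRing.scale/= addrC [g x * _]mulrC.
Qed.

(** Quadratic polynomials are the only outer functions that occur: scalings, radial tests in |y - z|
    ^ 2, quartic perturbations and the test used at zeros of the solution are all of this form. *)
Lemma jet2_quad (a0 a1 a2 : R) A f p X : open A -> jet2 A f p X ->
  jet2 A (fun x => a0 + a1 * f x + a2 * f x ^+ 2)
    (fun i x => (a1 + 2 * a2 * f x) * p i x)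
    (fun i j x => (a1 + 2 * a2 * f x) * X i j x + 2 * a2 * p j x * p i x).
Proof.
move=> oA Jf x Ax i; have [df cf hf] := Jf x Ax i.
have fc := jet2_continuous oA Jf Ax.
have lc : {for x, continuous (fun y => a1 + 2 * a2 * f y)}.
  by apply: continuous_atD; [exact: continuous_at_cst|apply: continuous_atM => //; exact: continuous_at_cst].
have ld j : is_derive x (e_ j) (fun y => a1 + 2 * a2 * f y) (2 * a2 * p j x).
  have [dj _ _] := Jf x Ax j.
  exact: is_derive_cadd (is_derive_cmul _ dj).
split.
- have -> : (fun x => a0 + a1 * f x + a2 * f x ^+ 2) = (fun x => a0 + (a1 + a2 * f x) * f x).
    by apply/funext => y; ring.
  have -> : (a1 + 2 * a2 * f x) * p i x = a2 * p i x * f x + (a1 + a2 * f x) * p i x by ring.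
  exact: is_derive_cadd (is_derive_mul (is_derive_cadd _ (is_derive_cmul _ df)) df).
- exact: continuous_atM.
- move=> j; have [df2 cf2] := hf j; split.
    rewrite addrC; exact: is_derive_mul (ld j) df2.
  have [_ cj _] := Jf x Ax j.
  by apply: continuous_atD; [exact: continuous_atM|apply: continuous_atM => //; apply: continuous_atM => //; exact: continuous_at_cst].
Qed.

Lemma jet2_sqn A z : jet2 A (fun y => sqn (y - z)) (fun i y => 2 * (y - z) 0 i)
  (fun i j _ => 2 * (i == j)%:R).
Proof.
move=> x _ i; split.
- apply: (@is_derive_quadratic_line _ _ _ _ _ _ 1) => s.
  rewrite /sqn (bigD1 i)//= [in RHS](bigD1 i)//=.
  under eq_bigr => k ki do rewrite !mxE (negPf ki) andbF mulr0 addr0 -[x 0 k - z 0 k]/(x 0 k - z 0 k).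
  rewrite !mxE !eqxx/=.
  under [in RHS]eq_bigr => k ki do rewrite !mxE.
  ring.
- apply: continuous_atM; first exact: continuous_at_cst.
  apply/continuous_enP => e e0; exists e => // y ye.
  apply: le_lt_trans ye; apply: le_trans (coord_le_en _ i).
  by rewrite !mxE opprB addrA subrK.
- move=> j; split; last exact: continuous_at_cst.
  apply: (@is_derive_quadratic_line _ _ _ _ _ _ 0) => s.
  by rewrite !mxE eqxx/= mulr0 addr0; ring.
Qed.

(** For h quadratic, the Hessian of h o f is h' D^2 f plus the rank-one part h'' Df (Df)^T;
    evaluated on the gradient h' Df, the latter contributes h' ^ 2 h'' |Df| ^ 4. *)
Lemma laplacian_quad (a0 a1 a2 : R) A f p X x : open A -> jet2 A f p X -> A x ->
  infinity_laplacian (fun x => a0 + a1 * f x + a2 * f x ^+ 2) x =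
  (a1 + 2 * a2 * f x) ^+ 2 * ((a1 + 2 * a2 * f x) * infinity_laplacian f x +
    2 * a2 * (\sum_i p i x ^+ 2) ^+ 2).
Proof.
move=> oA J Ax; rewrite (jet2_laplacian oA (jet2_quad a0 a1 a2 oA J) Ax).
rewrite (jet2_laplacian oA J Ax) [X in _ * (_ + _ * X)]expr2 mulr_suml mulrDr !mulr_sumr -big_split/=.
apply: eq_bigr => i _; rewrite !mulr_sumr -big_split/=; apply: eq_bigr => j _; ring.
Qed.

(** Subtracting |x - z| ^ 2 makes the inner function vanish at x, so that [a1] and [2 * a2] are the
    outer derivatives there. *)
Lemma laplacian_radial (a0 a1 a2 : R) A z x : open A -> A x ->
  infinity_laplacian (fun y => a0 + a1 * (sqn (y - z) - sqn (x - z)) +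
    a2 * (sqn (y - z) - sqn (x - z)) ^+ 2) x =
  a1 ^+ 2 * (8 * a1 * sqn (x - z) + 32 * a2 * sqn (x - z) ^+ 2).
Proof.
move=> oA Ax; set c := sqn (x - z).
have J := @jet2_sqn A z.
have J1 : jet2 A (fun y => sqn (y - z) - c) (fun i y => 2 * (y - z) 0 i)
    (fun i j _ => 2 * (i == j)%:R).
  have := jet2_quad (- c) 1 0 oA J.
  have -> : (fun y => - c + 1 * sqn (y - z) + 0 * sqn (y - z) ^+ 2) = (fun y => sqn (y - z) - c).
    by apply/funext => y; ring.
  have -> : (fun i y => (1 + 2 * 0 * sqn (y - z)) * (2 * (y - z) 0 i)) = (fun i y => 2 * (y - z) 0 i).
    by apply/funext => i; apply/funext => y; ring.
  have -> // : (fun i j y => (1 + 2 * 0 * sqn (y - z)) * (2 * (i == j)%:R) + 2 * 0 * (2 * (y - z) 0 j) * (2 * (y - z) 0 i)) = (fun i j (_ : 'rV[R]_n) => 2 * (i == j)%:R).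
  by apply/funext => i; apply/funext => j; apply/funext => y; ring.
rewrite (laplacian_quad a0 a1 a2 oA J1 Ax) (jet2_laplacian oA J1 Ax) subrr mulr0 addr0.
have -> : \sum_i (2 * (x - z) 0 i) ^+ 2 = 4 * c.
  by rewrite /c /sqn mulr_sumr; apply: eq_bigr => i _; ring.
have -> : \sum_i \sum_j 2 * (x - z) 0 i * (2 * (j == i)%:R) * (2 * (x - z) 0 j) = 8 * c.
  rewrite /c /sqn mulr_sumr; apply: eq_bigr => i _.
  rewrite (bigD1 i)//= eqxx big1 ?addr0; first by rewrite /=; ring.
  by move=> j /negPf ->; rewrite !(mulr0, mul0r).
ring.
Qed.

Lemma C2_radial (a0 a1 a2 c : R) A z : open A ->
  C2_on A (fun y => a0 + a1 * (sqn (y - z) - c) + a2 * (sqn (y - z) - c) ^+ 2).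
Proof.
move=> oA; have -> : (fun y => a0 + a1 * (sqn (y - z) - c) + a2 * (sqn (y - z) - c) ^+ 2) =
  (fun y => (a0 - a1 * c + a2 * c ^+ 2) + (a1 - 2 * a2 * c) * sqn (y - z) + a2 * sqn (y - z) ^+ 2).
  by apply/funext => y; ring.
exact: jet2_C2 oA (jet2_quad _ _ _ oA (@jet2_sqn A z)).
Qed.
End Jets.

(** A one-sided second-order Taylor bound with slope s and second derivative m: all that is required
    of [g] in order to place a C2 function above it. *)
Definition expands (R : realType) (g : R -> R) (rho s m : R) :=
  exists2 r0 : R, 0 < r0 & forall r, `|r - rho| < r0 ->
    g r <= g rho + s * (r - rho) + m / 2 * (r - rho) ^+ 2.

(** * Maximum principle for C2 functions and radial test functions *)

Section MaximumTests.
Variables (R : realType) (n : nat).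
Implicit Types (x y z v : 'rV[R]_n) (f g : 'rV[R]_n -> R) (A : set 'rV[R]_n).

Local Notation e_ i := (delta_mx 0 i : 'rV[R]_n).

Lemma is_derive_bigsum (I : Type) (r : seq I) (F : I -> 'rV[R]_n -> R) (d : I -> R) x v :
  (forall i, is_derive x v (F i) (d i)) ->
  is_derive x v (fun y => \sum_(i <- r) F i y) (\sum_(i <- r) d i).
Proof.
move=> H; elim: r => [|i r IH].
  have -> : (fun y => \sum_(i <- [::]) F i y) = cst 0.
    by apply/funext => y; rewrite big_nil.
  by rewrite big_nil; exact: is_derive_cst.
have -> : (fun y => \sum_(j <- i :: r) F j y) = (fun y => F i y + \sum_(j <- r) F j y).
  by apply/funext => y; rewrite big_cons.
by rewrite big_cons; exact: (is_deriveD (H i) IH).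
Qed.

(** Restricted to the line through x in direction v, f has derivative [G v], which vanishes at 0. If
    the Hessian form were positive on v, [G v] would be positive just after 0 and f would increase
    beyond its maximum. *)
Lemma jet2_local_max A f p X x : open A -> jet2 A f p X -> A x -> local_max f x ->
  (forall i, p i x = 0) /\ forall v, \sum_i \sum_j v 0 i * v 0 j * X i j x <= 0.
Proof.
move=> oA J Ax fx.
have [r r0 rP] : exists2 r, 0 < r & forall y, en (y - x) < r -> A y /\ f y <= f x.
  by apply/near_enP; apply: filterI fx; exact: open_nbhs_nbhs.
have line v : exists2 d : R, 0 < d & forall s, `|s| < d -> A (x + s *: v) /\ f (x + s *: v) <= f x.
  have v1 : 0 < en v + 1 by rewrite ltr_wpDl// en_ge0.
  exists (r / (en v + 1)); first by rewrite divr_gt0.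
  move=> s; rewrite ltr_pdivlMr// => sr; apply: rP.
  rewrite addrAC subrr add0r enZ; apply: le_lt_trans sr.
  by rewrite ler_wpM2l// lerDl.
pose G v s := \sum_i v 0 i * p i (x + s *: v).
have dF v s : A (x + s *: v) -> is_derive s (1 : R) (fun s => f (x + s *: v)) (G v s).
  by move=> As; apply/is_derive_line; exact: jet2_is_derive J As.
have G0 v : G v 0 = 0.
  have [d d0 dP] := line v.
  have I0 : (0 : R) \in `](- d), d[%R by rewrite in_itv/= oppr_lt0 d0.
  have K s : s \in `](- d), d[%R -> `|s| < d by rewrite in_itv/= ltr_norml.
  have [_ <-] : is_derive (0 : R) (1 : R) (fun s => f (x + s *: v)) (G v 0).
    by apply: dF; apply: (dP 0 _).1; rewrite normr0.
  apply: (@derive_val _ _ _ _ _ _ _ _).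
  apply: (@derive1_at_max R (fun s => f (x + s *: v)) (- d) d 0); last 1 first.
  - by move=> t /K /dP[_]; rewrite scale0r addr0.
  - by have := ltW d0; lra.
  - by move=> t /K /dP[At _]; have [] := dF v t At.
  - exact: I0.
have p0 i : p i x = 0.
  rewrite -(G0 (e_ i)) /G scale0r addr0 (bigD1 i)//= big1 ?addr0.
    by rewrite mxE !eqxx mul1r.
  by move=> k ki; rewrite mxE (negPf ki) andbF mul0r.
split=> // v.
under eq_bigr do (under eq_bigr do rewrite -mulrA; rewrite -mulr_sumr).
set D := \sum_i _; rewrite leNgt; apply/negP => D0.
have [d d0 dP] := line v.
have dG : is_derive (0 : R) (1 : R) (G v) D.
  apply/(@is_derive_line _ _ (fun y => \sum_i v 0 i * p i y)).
  rewrite scale0r addr0; apply: is_derive_bigsum => i.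
  exact: is_derive_cmul (jet2_is_derive2 _ _ oA J Ax).
have Gpos : \forall h \near 0^', 0 < h^-1 * G v h.
  have : (fun h : R => h^-1 *: ((G v \o shift 0) (h *: (1:R)) - G v 0)) @ 0^' --> D.
    by have [+ <-] := dG.
  move/cvgrPdist_lt => /(_ D D0); apply: filterS => h /=.
  rewrite G0 subr0 addr0 [h *: 1]mulr1 [_ *: _]/(_ * _) => /ltr_normlP[_].
  by rewrite ltrBlDr ltrDl.
move: Gpos; rewrite near_withinE => /nbhs_normP[d' /= d'0 d'P].
pose s := Num.min d d' / 2.
have m0 : 0 < Num.min d d' by rewrite lt_min d0.
have s0 : 0 < s by rewrite divr_gt0.
have sd : s < d by rewrite (lt_le_trans (y := Num.min d d'))// ?ge_min ?lexx// /s; lra.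
have sd' : s < d' by rewrite (lt_le_trans (y := Num.min d d'))// ?ge_min ?lexx ?orbT// /s; lra.
have H t : t \in `[0, s]%R -> `|t| < d.
  by rewrite in_itv/= => /andP[t0 ts]; rewrite ger0_norm//; exact: le_lt_trans sd.
have [c cI] : exists2 c, c \in `]0, s[%R & f (x + s *: v) - f (x + 0 *: v) = G v c * (s - 0).
  apply: (@MVT _ (fun s => f (x + s *: v))) => // [t tI|].
    by apply: dF; apply: (dP t _).1; apply: H; exact: subset_itv_oo_cc.
  apply: derivable_within_continuous => t tI.
  by have [] := dF v t (dP t (H t tI)).1.
move: cI; rewrite in_itv/= => /andP[c0 cs].
rewrite scale0r addr0 subr0 => E.
have : 0 < G v c.
  have := d'P c; rewrite /= sub0r normrN gtr0_norm// => /(_ (lt_trans cs sd')).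
  by rewrite gt_eqF// => /(_ isT); rewrite pmulr_rgt0// invr_gt0.
have sI : s \in `[0, s]%R by rewrite in_itv/= lexx ltW.
have [_] := dP s (H s sI).
by rewrite -subr_le0 E pmulr_lle0// => /le_lt_trans /[apply]; rewrite ltxx.
Qed.

Lemma jet2_sub A f p X g q Y : jet2 A f p X -> jet2 A g q Y ->
  jet2 A (fun x => f x - g x) (fun i x => p i x - q i x)
    (fun i j x => X i j x - Y i j x).
Proof.
move=> Jf Jg x Ax i.
have [df cf hf] := Jf x Ax i; have [dg cg hg] := Jg x Ax i; split.
- exact: is_deriveB.
- exact: (continuousB cf cg).
- move=> j; have [df2 cf2] := hf j; have [dg2 cg2] := hg j; split.
    exact: is_deriveB.
  exact: (continuousB cf2 cg2).
Qed.

(** The two gradients agree at x, so the ordering of the Hessians can be evaluated on the common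
    gradient. *)
Lemma laplacian_le_local_max A f g x : open A -> C2_on A f -> C2_on A g -> A x ->
  local_max (fun y => f y - g y) x ->
  infinity_laplacian f x <= infinity_laplacian g x.
Proof.
move=> oA /C2_jet2 Jf /C2_jet2 Jg Ax M.
have [p0 X0] := jet2_local_max oA (jet2_sub Jf Jg) Ax M.
have E i : partial i g x = partial i f x by have := p0 i; lra.
rewrite (jet2_laplacian oA Jf Ax) (jet2_laplacian oA Jg Ax) -subr_le0.
apply: le_trans (X0 (\row_i partial i f x)).
rewrite [leRHS]exchange_big/= -sumrB le_eqVlt; apply/orP; left; apply/eqP.
apply: eq_bigr => i _; rewrite -sumrB; apply: eq_bigr => j _.
rewrite !mxE !E /=.
move: (partial i f x) (partial j f x) (partial i (partial j f) x) (partial i (partial j g) x).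
by move=> p q a b; ring.
Qed.

Lemma partial_cst (c : R) i : partial i (fun _ : 'rV[R]_n => c) = (fun=> 0).
Proof. by apply/funext => x; exact: derive_cst. Qed.

Lemma C2_cst A (c : R) : C2_on A (fun=> c).
Proof.
move=> x _ i; rewrite !partial_cst; split; [exact: derivable_cst|exact: continuous_at_cst|].
by move=> j; rewrite partial_cst; split; [exact: derivable_cst|exact: continuous_at_cst].
Qed.

Lemma laplacian_cst (c : R) x : infinity_laplacian (fun=> c) x = 0.
Proof. by rewrite /infinity_laplacian big1// => i _; rewrite big1// => j _; rewrite partial_cst !mul0r. Qed.

Lemma laplacian_scale A (c : R) f x : open A -> C2_on A f -> A x ->
  infinity_laplacian (fun y => c * f y) x = c ^+ 3 * infinity_laplacian f x.
Proof.
move=> oA /C2_jet2 J Ax; have := laplacian_quad 0 c 0 oA J Ax.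
have -> : (fun y => 0 + c * f y + 0 * f y ^+ 2) = (fun y => c * f y).
  by apply/funext => y; ring.
by move=> ->; ring.
Qed.

Lemma C2_scale A (c : R) f : open A -> C2_on A f -> C2_on A (fun y => c * f y).
Proof.
move=> oA /C2_jet2 J; have := jet2_C2 oA (jet2_quad 0 c 0 oA J).
have -> // : (fun y => 0 + c * f y + 0 * f y ^+ 2) = (fun y => c * f y).
by apply/funext => y; ring.
Qed.

Lemma laplacian_opp A f x : open A -> C2_on A f -> A x ->
  infinity_laplacian (fun y => - f y) x = - infinity_laplacian f x.
Proof.
move=> oA C Ax; have := laplacian_scale (-1) oA C Ax.
have -> : (fun y => -1 * f y) = (fun y => - f y) by apply/funext => y; ring.
by move=> ->; ring.
Qed.

Lemma C2_opp A f : open A -> C2_on A f -> C2_on A (fun y => - f y).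
Proof.
move=> oA /(C2_scale (-1) oA).
by have -> : (fun y => -1 * f y) = (fun y => - f y) by apply/funext => y; ring.
Qed.

(** A polynomial in |y - z| ^ 2 is C2 everywhere, its centre included. Matching slope s and second
    derivative m' at rho leaves the surplus (m' - m) / 2 in the quadratic term, which dominates the
    higher-order terms near rho. *)
Lemma radial_test A z x (g : R -> R) (s m m' : R) : open A -> A x ->
  let rho := en (x - z) in 0 < rho -> m < m' ->
  expands g rho s m ->
  exists T : 'rV[R]_n -> R, [/\ C2_on A T, \forall y \near x, g (en (y - z)) <= T y,
    T x = g rho & infinity_laplacian T x = s ^+ 2 * m'].
Proof.
move=> oA Ax rho rho0 mm' [r0 r00 gP].
(* These solve 2 rho a1 = s and 2 a1 + 8 rho ^ 2 a2 = m', the first and second derivative in r of a1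
   (r ^ 2 - rho ^ 2) + a2 (r ^ 2 - rho ^ 2) ^ 2 at rho. *)
pose a1 := s / (2 * rho); pose k := m' - s / rho; pose a2 := k / (8 * rho ^+ 2).
have rhon0 : rho != 0 by rewrite gt_eqF.
exists (fun y => g rho + a1 * (sqn (y - z) - sqn (x - z)) + a2 * (sqn (y - z) - sqn (x - z)) ^+ 2).
split; [exact: C2_radial| |by rewrite subrr mulr0 expr0n mulr0 !addr0|]; last first.
  rewrite (laplacian_radial _ _ _ _ oA Ax) -en_sqr -/rho /a1 /a2 /k; field.
  by rewrite rhon0.
have k1 : 0 < `|k| + 1 by rewrite ltr_wpDl.
have rm : 0 < rho * (m' - m) / (2 * (`|k| + 1)) by rewrite divr_gt0 ?mulr_gt0 ?subr_gt0.
apply/near_enP; exists (Num.min r0 (Num.min rho (rho * (m' - m) / (2 * (`|k| + 1))))).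
  by rewrite !lt_min r00 rho0.
move=> y; rewrite !lt_min => /and3P[y1 y2 y3].
pose t := en (y - z) - rho.
have ty : `|t| <= en (y - x).
  by apply: le_trans (en_lip _ _) _; rewrite opprB addrA subrK.
have {}y1 := le_lt_trans ty y1; have {}y2 := le_lt_trans ty y2; have {}y3 := le_lt_trans ty y3.
apply: le_trans (gP _ y1) _; rewrite -/t -!en_sqr -/rho.
have -> : en (y - z) ^+ 2 - rho ^+ 2 = t * (2 * rho + t) by rewrite /t; ring.
rewrite -addrA -addrA lerD2l -subr_ge0.
have -> : a1 * (t * (2 * rho + t)) + a2 * (t * (2 * rho + t)) ^+ 2 - (s * t + m / 2 * t ^+ 2) =
   t ^+ 2 * ((m' - m) / 2 + k * t * (1 + t / (4 * rho)) / (2 * rho)).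
  by rewrite /a1 /a2 /k; field; rewrite rhon0.
apply: mulr_ge0; first exact: sqr_ge0.
suff : `|k * t * (1 + t / (4 * rho)) / (2 * rho)| <= (m' - m) / 2.
  by move/ler_normlP => [? _]; lra.
move: y3; rewrite ltr_pdivlMr ?mulr_gt0// => y3.
have b1 : `|1 + t / (4 * rho)| <= 2.
  apply: le_trans (ler_normD _ _) _; rewrite normr1 normrM normfV (gtr0_norm (x := 4 * rho)) ?mulr_gt0//.
  suff : `|t| / (4 * rho) <= 1 by lra.
  by rewrite ler_pdivrMr ?mulr_gt0//; lra.
rewrite !normrM normfV (gtr0_norm (x := 2 * rho)) ?mulr_gt0// ler_pdivrMr ?mulr_gt0//.
apply: (@le_trans _ _ (`|k| * `|t| * 2)); first by rewrite ler_wpM2l.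
have := normr_ge0 t; nra.
Qed.

(** The viscosity inequality with a constant right-hand side, tested at points of U by functions C2
    on A, as in [viscosity_subsolution]. Supersolutions enter through [- v]. *)
Definition laplacian_ge A (U : set 'rV[R]_n) (w : 'rV[R]_n -> R) (B : R) :=
  forall (f : 'rV[R]_n -> R) x, C2_on A f -> U x ->
    local_max (fun y => w y - f y) x -> B <= infinity_laplacian f x.

Lemma radial_touch A U w (B : R) z x (g : R -> R) (s m : R) : open A -> U `<=` A ->
  laplacian_ge A U w B -> U x ->
  let rho := en (x - z) in 0 < rho ->
  expands g rho s m ->
  local_max (fun y => w y - g (en (y - z))) x -> B <= s ^+ 2 * m.
Proof.
move=> oA UA W Ux rho rho0 gP M.
have H m' : m < m' -> B <= s ^+ 2 * m'.
  move=> mm'; have [T [C Tn Tx <-]] := radial_test oA (UA _ Ux) rho0 mm' gP.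
  apply: W => //; apply: filterS2 M Tn => y.
  by rewrite Tx -/rho; lra.
rewrite leNgt; apply/negP => sB.
have s2 : 0 < s ^+ 2 + 1 by rewrite ltr_wpDl// sqr_ge0.
have := H (m + (B - s ^+ 2 * m) / (2 * (s ^+ 2 + 1))).
rewrite ltrDl divr_gt0 ?mulr_gt0 ?subr_gt0// => /(_ isT).
apply/negP; rewrite -ltNge mulrDr -ltrBrDl mulrA ltr_pdivrMr ?mulr_gt0//.
have := sqr_ge0 s; nra.
Qed.
End MaximumTests.

(** * The one-dimensional radial equation *)

Section Profile.
Variable R : realType.
Implicit Types (a b c r s t x y : R).

(** Extended by 0 to negative arguments, which keeps it monotone and continuous and makes [profile]
    continuous on the whole line. *)
Definition cbrt x : R := (Num.max x 0) `^ 3^-1.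

Lemma cbrt_ge0 x : 0 <= cbrt x. Proof. exact: powR_ge0. Qed.

Lemma cbrt_max x : cbrt x ^+ 3 = Num.max x 0.
Proof.
have m0 : 0 <= Num.max x 0 by rewrite le_max lexx orbT.
by rewrite /cbrt -powR_mulrn ?powR_ge0// -powRrM mulVf// powRr1.
Qed.

Lemma cbrtK x : 0 <= x -> cbrt x ^+ 3 = x.
Proof. by move=> x0; rewrite cbrt_max; apply/max_idPl. Qed.

Lemma cbrt0 : cbrt 0 = 0.
Proof. by rewrite /cbrt maxxx powR0// invr_eq0. Qed.

Lemma exprK_cbrt x : 0 <= x -> cbrt (x ^+ 3) = x.
Proof.
move=> x0; apply/eqP; rewrite -(@eqrXn2 _ 3)// ?cbrt_ge0// cbrtK//.
exact: exprn_ge0.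
Qed.

Lemma ler_cbrt x y : x <= y -> cbrt x <= cbrt y.
Proof.
move=> xy; rewrite -(@ler_pXn2r _ 3)// ?nnegrE ?cbrt_ge0// !cbrt_max.
by rewrite ge_max !le_max xy lexx orbT.
Qed.

Lemma cbrt_le x y : 0 <= x -> 0 <= y -> cbrt x <= cbrt y -> x <= y.
Proof.
move=> x0 y0; rewrite -(@ler_pXn2r _ 3)// ?nnegrE ?cbrt_ge0//.
by rewrite !cbrtK.
Qed.

Lemma cbrt_gt0 x : 0 < x -> 0 < cbrt x.
Proof.
move=> x0; rewrite lt_def cbrt_ge0 andbT; apply/eqP => H.
by have := cbrtK (ltW x0); rewrite H expr0n/= => /eqP; rewrite lt_eqF.
Qed.

Lemma continuous_cbrt : continuous cbrt.
Proof.
move=> x; apply/(@cvgrPdist_lt _ _ _ (nbhs x)) => e e0.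
have e3 : 0 < e ^+ 3 by rewrite exprn_gt0.
apply/nbhs_normP; exists (e ^+ 3) => //= y /= xy.
wlog le_xy : x y xy / x <= y => [H|].
  have [le_xy|/ltW le_yx] := leP x y; first exact: H.
  by rewrite distrC; apply: H => //; rewrite distrC.
rewrite distrC ger0_norm ?subr_ge0 ?ler_cbrt//.
rewrite -(@ltr_pXn2r _ 3)// ?nnegrE ?subr_ge0 ?ler_cbrt ?(ltW e0)//.
apply: le_lt_trans xy; rewrite distrC ger0_norm ?subr_ge0//.
(* For 0 <= p <= q one has (q - p) ^ 3 <= q ^ 3 - p ^ 3: the cube root is Hoelder continuous of
   order 1/3. *)
apply: (@le_trans _ _ (cbrt y ^+ 3 - cbrt x ^+ 3)).
  have := ler_cbrt le_xy; have := cbrt_ge0 x; set p := cbrt x; set q := cbrt y => p0 pq.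
  have : 0 <= p * q * (q - p) by rewrite !mulr_ge0 ?subr_ge0// (le_trans p0).
  nra.
rewrite !cbrt_max; case: (leP x 0); case: (leP y 0) => ? ?; rewrite ?subr0 ?subrr; lra.
Qed.

(* The solution of [g' ^ 2 * g'' = b], [g 0 = 0], [g' 0 = cbrt c]. *)
Definition profile b c r : R := (cbrt (3 * b * r + c) ^+ 4 - cbrt c ^+ 4) / (4 * b).

Lemma profile0 b c : profile b c 0 = 0.
Proof. by rewrite /profile mulr0 add0r subrr mul0r. Qed.

Lemma cvg_expn (f : R -> R) (x l : R) (k : nat) :
  f r @[r --> x] --> l -> f r ^+ k @[r --> x] --> l ^+ k.
Proof.
move=> fl; elim: k => [|k IH].
  by have -> : (fun r => f r ^+ 0) = cst 1 by []; exact: cvg_cst.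
have -> : (fun r => f r ^+ k.+1) = (fun r => f r * f r ^+ k) by apply/funext => r; rewrite exprS.
by rewrite exprS; exact: (cvgM fl IH).
Qed.

Lemma continuous_lin (p q : R) : continuous (fun r => p * r + q).
Proof. by move=> r; apply: cvgD; [apply: cvgM; [exact: cvg_cst|exact: cvg_id]|exact: cvg_cst]. Qed.

Lemma continuous_cbrt_lin (p q : R) : continuous (fun r => cbrt (p * r + q)).
Proof.
move=> r; apply: (continuous_comp (f := fun r => p * r + q)); last exact: continuous_cbrt.
exact: continuous_lin.
Qed.

Lemma continuous_profile b c : continuous (profile b c).
Proof.
move=> r; apply: cvgM; last exact: cvg_cst.
apply: cvgB; last exact: cvg_cst.
by apply: cvg_expn; exact: continuous_cbrt_lin.
Qed.

Lemma continuous_profile_c b r : continuous (fun c => profile b c r).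
Proof.
move=> c; apply: cvgM; last exact: cvg_cst.
apply: cvgB; apply: cvg_expn; last exact: continuous_cbrt.
have -> : (fun c => cbrt (3 * b * r + c)) = (fun c => cbrt (1 * c + 3 * b * r)).
  by apply/funext => d; rewrite mul1r addrC.
have -> : 3 * b * r + c = 1 * c + 3 * b * r by rewrite mul1r addrC.
exact: continuous_cbrt_lin.
Qed.

Lemma le_profile b c r s : b != 0 -> r <= s ->
  profile b c r <= profile b c s.
Proof.
move=> b0 rs; rewrite /profile.
have [b1|b1] : b < 0 \/ 0 < b by apply/orP; rewrite -neq_lt.
  rewrite ler_ndivlMr ?pmulr_rlt0//; rewrite mulrVK ?unitfE ?mulf_neq0//.
  rewrite lerD2r lerXn2r ?nnegrE ?cbrt_ge0// ler_cbrt// lerD2r.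
  by rewrite ler_nM2l// pmulr_rlt0.
rewrite ler_pM2r ?invr_gt0 ?mulr_gt0// lerD2r lerXn2r ?nnegrE ?cbrt_ge0// ler_cbrt// lerD2r.
by rewrite ler_pM2l// mulr_gt0.
Qed.

(** A solution for a, read backwards from r = l, solves the equation for - a. It serves as radial
    bound for [- v]: with a > 0 and c >= 0 its slope decreases but stays positive before r = l. *)
Lemma profile_reverse a c r l : a != 0 ->
  profile (- a) (3 * a * l + c) r = profile a c l - profile a c (l - r).
Proof.
move=> a0; rewrite /profile.
have -> : 3 * - a * r + (3 * a * l + c) = 3 * a * (l - r) + c by ring.
by field.
Qed.

(* With [t ^ 3 = 3 b r + c] and [s ^ 3 = 3 b rho + c], both sides of the second-order
   expansion are polynomials in [t] divisible by [(t - s) ^ 2]. *)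
Lemma profile_expand b c rho m : b != 0 -> 0 < 3 * b * rho + c ->
  let s := cbrt (3 * b * rho + c) in b < s ^+ 2 * m ->
  expands (profile b c) rho s m.
Proof.
move=> b0 pos s bm; have s0 : 0 < s by exact: cbrt_gt0.
pose T r := cbrt (3 * b * r + c).
pose h r := m * (T r ^+ 2 + T r * s + s ^+ 2) ^+ 2 / (18 * b ^+ 2) -
  (3 * T r ^+ 2 + 2 * T r * s + s ^+ 2) / (12 * b).
have cT : {for rho, continuous T} by exact: continuous_cbrt_lin.
have b2 : 0 < b ^+ 2 by rewrite exprn_even_gt0.
have h0 : 0 < h rho.
  have -> : h rho = s ^+ 2 / (2 * b ^+ 2) * (s ^+ 2 * m - b).
    by rewrite /h /T -/s; field.
  by rewrite mulr_gt0 ?subr_gt0// divr_gt0 ?exprn_gt0// mulr_gt0.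
have cT2 : T r ^+ 2 @[r --> rho] --> T rho ^+ 2 by exact: cvg_expn.
have ch : h r @[r --> rho] --> h rho.
  apply: cvgB; apply: cvgM; do ?exact: cvg_cst; last first.
    apply: cvgD; last exact: cvg_cst.
    apply: cvgD; first by apply: cvgM => //; exact: cvg_cst.
    by apply: cvgM; [apply: cvgM => //; exact: cvg_cst|exact: cvg_cst].
  apply: cvgM; first exact: cvg_cst.
  apply: cvg_expn.
  apply: cvgD; last exact: cvg_cst.
  by apply: cvgD => //; apply: cvgM => //; exact: cvg_cst.
have : \forall r \near rho, 0 < h r /\ 0 < 3 * b * r + c.
  apply: filterI; first by apply: (cvgr_gt _ ch).
  by apply: (cvgr_gt _ (@continuous_lin (3 * b) c rho)).
move/nbhs_normP => [r0 /= r00 H]; exists r0 => // r rr.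
have /H[hr rpos] : `|rho - r| < r0 by rewrite distrC.
have Er : 3 * b * r + c = T r ^+ 3 by rewrite cbrtK// ltW.
have Erho : 3 * b * rho + c = s ^+ 3 by rewrite cbrtK// ltW.
have D : r - rho = (T r ^+ 3 - s ^+ 3) / (3 * b) by rewrite -Er -Erho; field.
rewrite -subr_ge0 D /profile -/s -/(T r).
have -> : (s ^+ 4 - cbrt c ^+ 4) / (4 * b) + s * ((T r ^+ 3 - s ^+ 3) / (3 * b)) +
   m / 2 * ((T r ^+ 3 - s ^+ 3) / (3 * b)) ^+ 2 - (T r ^+ 4 - cbrt c ^+ 4) / (4 * b) =
  (T r - s) ^+ 2 * h r by rewrite /h; field.
by rewrite mulr_ge0 ?sqr_ge0// ltW.
Qed.

Lemma is_derive_profile b c r : b != 0 -> 0 < 3 * b * r + c ->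
  is_derive r (1 : R) (profile b c) (cbrt (3 * b * r + c)).
Proof.
move=> b0 pos; set s := cbrt _.
have s0 : 0 < s by exact: cbrt_gt0.
pose L r := 3 * b * r + c.
have dL : is_derive r (1 : R) L (3 * b).
  have -> : L = (3 * b) *: id + cst c by [].
  by apply: is_derive_eq; rewrite addr0 [_ *: _]mulr1.
have dp := is_derive1_powR (4 / 3) pos.
have dc : is_derive r (1 : R) ((fun x => x `^ (4 / 3)) \o L) (4 / 3 * (L r) `^ (4 / 3 - 1) * (3 * b)).
  exact: is_derive1_comp.
have dq : is_derive r (1 : R) (fun r => (L r) `^ (4 / 3) - cbrt c ^+ 4) (4 / 3 * (L r) `^ (4 / 3 - 1) * (3 * b)).
  rewrite -[X in is_derive _ _ _ X]subr0; exact: (is_deriveB dc (is_derive_cst _ _ _)).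
have E : cbrt (3 * b * r + c) = (4 * b)^-1 * (4 / 3 * (L r) `^ (4 / 3 - 1) * (3 * b)).
  rewrite /cbrt; have -> : Num.max (3 * b * r + c) 0 = L r by apply/max_idPl; exact: ltW.
  have -> : 4 / 3 - 1 = 3^-1 :> R by field.
  by field.
rewrite /s E; apply: (@near_eq_is_derive _ _ _ (fun r => (4 * b)^-1 * ((L r) `^ (4 / 3) - cbrt c ^+ 4))).
  have : \forall x \near r, 0 < L x.
    by apply: (cvgr_gt _ (@continuous_lin (3 * b) c r)).
  apply: filterS => x Lx; rewrite /profile mulrC; congr ((_ - _) / _).
  rewrite /cbrt -powR_mulrn ?powR_ge0// -powRrM.
  have -> : 3^-1 * 4%:R = 4 / 3 :> R by field.
  by have -> : Num.max (3 * b * x + c) 0 = L x by apply/max_idPl; exact: ltW.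
Qed.

Lemma profile_ge_lin b c r : 0 < b -> 0 <= c -> 0 <= r -> cbrt c * r <= profile b c r.
Proof.
move=> b0 c0 r0; rewrite /profile ler_pdivlMr ?mulr_gt0//.
have pos : 0 <= 3 * b * r + c by rewrite addr_ge0 ?mulr_ge0// ltW.
set t := cbrt (_ + _); set s := cbrt c.
have Et : 3 * b * r = t ^+ 3 - s ^+ 3 by rewrite !cbrtK//; ring.
have -> : s * r * (4 * b) = 4 / 3 * s * (t ^+ 3 - s ^+ 3) by rewrite -Et; field.
(* The product is 3 t ^ 4 - 4 t ^ 3 s + s ^ 4, the height above the tangent at 0 up to a positive
   factor. *)
have : 0 <= (t - s) ^+ 2 * (3 * t ^+ 2 + 2 * t * s + s ^+ 2).
  have := cbrt_ge0 c; have := cbrt_ge0 (3 * b * r + c); rewrite -/s -/t => ? ?.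
  by rewrite mulr_ge0 ?sqr_ge0// !addr_ge0// ?mulr_ge0// ?sqr_ge0.
nra.
Qed.

(** Intermediate value theorem in c: c = 0 gives at most X, and by the tangent line at 0 the value c
    = (X / l) ^ 3 gives at least X. *)
Lemma profile_surj b l X : 0 < b -> 0 < l -> profile b 0 l <= X ->
  exists2 c, 0 <= c & profile b c l = X.
Proof.
move=> b0 l0 lX.
have X0 : 0 <= X.
  apply: le_trans lX; have := profile_ge_lin b0 (lexx 0) (ltW l0).
  by rewrite cbrt0 mul0r.
pose C := (X / l) ^+ 3.
have Xl : 0 <= X / l by rewrite divr_ge0// ltW.
have C0 : 0 <= C by exact: exprn_ge0.
have CX : X <= profile b C l.
  have := profile_ge_lin b0 C0 (ltW l0).
  by rewrite exprK_cbrt// divfK// gt_eqF.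
have cf : {within `[0, C], continuous (fun c => profile b c l)}.
  by apply: continuous_subspaceT; exact: continuous_profile_c.
have B : Num.min (profile b 0 l) (profile b C l) <= X <= Num.max (profile b 0 l) (profile b C l).
  by apply/andP; split; rewrite ?ge_min ?lX// le_max CX orbT.
have [c] := IVT C0 cf B.
by rewrite in_itv/= => /andP[c0 _] <-; exists c.
Qed.

(** The difference D of the profiles for a and b satisfies D 0 = 0, D e <= 0 and D e <= D (2 e), so
    its derivative is nonpositive at some r1 < e and nonnegative at some r2 > e. But the cubes of
    the slopes differ by c - d - 3 (b - a) r, which strictly decreases. *)
Lemma profile_half a b c d e : 0 < a -> a < b -> 0 <= c -> 0 <= d -> 0 < e ->
  profile a c e <= profile b d e ->
  profile b d (2 * e) - profile b d e <= profile a c (2 * e) - profile a c e ->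
  False.
Proof.
move=> a0 ab c0 d0 e0 H1 H2.
have b0 := lt_trans a0 ab.
pose D r := profile a c r - profile b d r.
pose dD r := cbrt (3 * a * r + c) - cbrt (3 * b * r + d).
have cD : continuous D by move=> r; apply: cvgB; exact: continuous_profile.
have DD r : 0 < r -> is_derive r (1 : R) D (dD r).
  move=> r0; apply: is_deriveB.
    by apply: is_derive_profile; rewrite ?gt_eqF// ltr_wpDr// !mulr_gt0.
  by apply: is_derive_profile; rewrite ?gt_eqF// ltr_wpDr// !mulr_gt0.
have [r1 r1I E1] : exists2 r1, r1 \in `]0, e[%R & D e - D 0 = dD r1 * (e - 0).
  apply: MVT => // [r|]; first by rewrite in_itv/= => /andP[r0 _]; exact: DD.
  exact: continuous_subspaceT.
have ee : e < 2 * e by lra.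
have [r2 r2I E2] : exists2 r2, r2 \in `]e, (2 * e)[%R & D (2 * e) - D e = dD r2 * (2 * e - e).
  apply: MVT => // [r|]; first by rewrite in_itv/= => /andP[r0 _]; apply: DD; exact: lt_trans r0.
  exact: continuous_subspaceT.
move: r1I r2I; rewrite !in_itv/= => /andP[r1p r1e] /andP[r2e _].
have r2p := lt_trans e0 r2e.
have D1 : dD r1 <= 0.
  rewrite -(pmulr_lle0 _ e0); move: E1; rewrite subr0 => <-.
  by rewrite /D !profile0 subrr subr0 subr_le0.
have D2 : 0 <= dD r2.
  rewrite -(pmulr_lge0 _ e0); have -> : e = 2 * e - e by ring.
  by rewrite -E2 /D; lra.
have nn k r x : 0 < k -> 0 < r -> 0 <= x -> 0 <= 3 * k * r + x.
  by move=> k0 r0 x0; rewrite addr_ge0// !mulr_ge0// ltW.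
have {}D1 : 3 * a * r1 + c <= 3 * b * r1 + d.
  by apply: cbrt_le; [exact: nn|exact: nn|rewrite -subr_le0].
have {}D2 : 3 * b * r2 + d <= 3 * a * r2 + c.
  by apply: cbrt_le; [exact: nn|exact: nn|rewrite -subr_ge0].
have : 0 < (b - a) * (r2 - r1) by rewrite mulr_gt0 ?subr_gt0//; exact: lt_trans r2e.
nra.
Qed.

Lemma profile_c0 b r : 0 < b -> 0 <= r -> profile b 0 r = 3 / 4 * r * cbrt (3 * b * r).
Proof.
move=> b0 r0; rewrite /profile cbrt0 expr0n/= subr0 addr0 exprS cbrtK ?mulr_ge0// ?ltW//.
by field; rewrite gt_eqF.
Qed.

(** With zero initial slope the profile is a multiple of r ^ (4/3), hence sublinear in comparison
    with k r near 0. *)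
Lemma profile_small b k : 0 < b -> 0 < k ->
  exists2 d, 0 < d & forall r, 0 <= r -> r < d -> profile b 0 r <= k * r.
Proof.
move=> b0 k0; exists (k ^+ 3 / (3 * b)); first by rewrite divr_gt0 ?exprn_gt0 ?mulr_gt0.
move=> r r0; rewrite ltr_pdivlMr ?mulr_gt0// => rk; rewrite profile_c0//.
have : cbrt (3 * b * r) <= k.
  by rewrite -[leRHS]exprK_cbrt ?(ltW k0)// ler_cbrt// mulrC ltW.
have := cbrt_ge0 (3 * b * r); nra.
Qed.

(** Superadditivity of t ^ (4/3) on nonnegative t. *)
Lemma profile_ge_c0 b c r : 0 < b -> 0 <= c -> 0 <= r -> profile b 0 r <= profile b c r.
Proof.
move=> b0 c0 r0; rewrite /profile ler_pM2r ?invr_gt0 ?mulr_gt0// cbrt0 expr0n/= subr0 addr0.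
have br : 0 <= 3 * b * r by rewrite !mulr_ge0// ltW.
set X := 3 * b * r in br *.
have tau : cbrt X <= cbrt (X + c) by rewrite ler_cbrt// lerDl.
have s : cbrt c <= cbrt (X + c) by rewrite ler_cbrt// lerDr.
rewrite lerBrDr ![_ ^+ 4]exprSr cbrtK// cbrtK// cbrtK ?addr_ge0// mulrDl.
by rewrite lerD// ler_wpM2l.
Qed.

Lemma profile_c0_lt a b r : 0 < a -> a < b -> 0 < r -> profile a 0 r < profile b 0 r.
Proof.
move=> a0 ab r0; have b0 := lt_trans a0 ab.
rewrite !profile_c0 ?ltW// ltr_pM2l ?mulr_gt0// ltNge; apply/negP => /cbrt_le.
have nn c : 0 < c -> 0 <= 3 * c * r by move=> c0; rewrite !mulr_ge0// ltW.
move=> /(_ (nn _ b0) (nn _ a0)).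
by rewrite ler_pM2r// ler_pM2l// leNgt ab.
Qed.
End Profile.

(** * Comparison with radial functions and the strict comparison on a ball *)

Section Comparison.
Variables (R : realType) (n : nat).
Implicit Types (x y z : 'rV[R]_n) (A U : set 'rV[R]_n) (w v : 'rV[R]_n -> R).

Lemma within_continuousB (K : set 'rV[R]_n) w v : {within K, continuous w} ->
  {within K, continuous v} -> {within K, continuous (fun y => w y - v y)}.
Proof. by move=> wc vc y; exact: (continuousB (wc y) (vc y)). Qed.

(** The maximum of [w y - g (|y - x|)] over the ball cannot lie strictly between centre and sphere,
    where s ^ 2 m < B contradicts [radial_touch]; the sphere is handled by the boundary hypothesis,
    and the value at the centre is w x. *)
Lemma radial_comparison A U w (B : R) x (l : R) (g : R -> R) : open A -> U `<=` A ->
  laplacian_ge A U w B -> 0 < l ->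
  (forall y, 0 < en (y - x) < l -> U y) ->
  {within [set y | en (y - x) <= l], continuous w} ->
  continuous g -> g 0 = 0 ->
  (forall rho, 0 < rho < l -> exists s m, s ^+ 2 * m < B /\ expands g rho s m) ->
  (forall y, en (y - x) = l -> w y <= w x + g l) ->
  forall y, en (y - x) <= l -> w y <= w x + g (en (y - x)).
Proof.
move=> oA UA W l0 lU wc gc g0 gP wl.
pose f y := w y - g (en (y - x)).
have gec : continuous (fun y => g (en (y - x))).
  by move=> y; apply: continuous_comp; [exact: continuous_en_sub|exact: gc].
have fc : {within [set y | en (y - x) <= l], continuous f}.
  exact: within_continuousB wc (continuous_subspaceT gec).
have xK : [set y | en (y - x) <= l] x by rewrite /= subrr en0 ltW.
have [c /= cl cM] := compact_max (ex_intro _ x xK) (compact_en_ball (x := x) (r := l)) fc.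
suff fcx : f c <= w x.
  by move=> y /cM fy; have := le_trans fy fcx; rewrite /f; lra.
rewrite leNgt; apply/negP => wfc.
have c0 : 0 < en (c - x).
  rewrite lt_def en_ge0 andbT; apply/eqP => /en_eq0/eqP; rewrite subr_eq0 => /eqP cx.
  by move: wfc; rewrite /f cx subrr en0 g0 subr0 ltxx.
have {}cl : en (c - x) < l.
  rewrite lt_def cl andbT; apply/eqP => /esym lc.
  by have := wl _ lc; move: wfc; rewrite /f lc; lra.
have [|s [m [sB E]]] := gP (en (c - x)); first by rewrite c0.
have := radial_touch oA UA W (lU c _) c0 E.
rewrite c0 cl => /(_ isT) H.
suff /H : local_max f c by rewrite leNgt sB.
apply/near_enP; exists (l - en (c - x)); first by rewrite subr_gt0.
move=> y yc; apply: cM; apply/ltW; apply: le_lt_trans (en_triangle c _ _) _.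
by rewrite -ltrBrDr.
Qed.

Lemma within_continuous_sub (K : set 'rV[R]_n) w :
  (forall y, K y -> {for y, continuous w}) -> {within K, continuous w}.
Proof. by move=> H; apply: continuous_in_subspaceT => y; rewrite inE; exact: H. Qed.

(** Cutting the segment into equal pieces no longer than r and adding up the increments. *)
Lemma chain_le w x y (k r : R) : 0 < r ->
  (forall p q, en (p - x) <= en (y - x) -> en (q - p) <= r -> w q <= w p + k * en (q - p)) ->
  w y <= w x + k * en (y - x).
Proof.
move=> r0 H; pose N := Num.bound (en (y - x) / r).
have NP : en (y - x) / r < N%:R by apply: archi_boundP; rewrite divr_ge0 ?en_ge0// ltW.
have N0 : 0 < N%:R :> R by apply: le_lt_trans NP; rewrite divr_ge0 ?en_ge0// ltW.
pose p i := x + (i%:R / N%:R) *: (y - x).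
have pS i : p i.+1 - p i = N%:R^-1 *: (y - x).
  rewrite /p opprD addrACA subrr add0r -scalerBl -mulrBl.
  by rewrite -natr1 addrAC subrr add0r mul1r.
have step i : (i <= N)%N -> w (p i) <= w x + k * (i%:R / N%:R * en (y - x)).
  elim: i => [|i IH] iN; first by rewrite /p !mul0r scale0r mulr0 !addr0.
  have pi : en (p i - x) <= en (y - x).
    rewrite /p addrAC subrr add0r enZ ger0_norm ?divr_ge0//.
    by rewrite ler_piMl ?en_ge0// ler_pdivrMr// mul1r ler_nat ltnW.
  have e : en (p i.+1 - p i) = N%:R^-1 * en (y - x).
    by rewrite pS enZ ger0_norm// invr_ge0.
  have := H (p i) (p i.+1) pi; rewrite e => /(_ _)/wrap[].
    by rewrite mulrC ler_pdivrMr// mulrC -ler_pdivrMr// ltW.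
  move/le_trans; apply; have := IH (ltnW iN) => {}IH.
  rewrite -natr1 mulrDl !mulrDl mulrDr addrA mul1r.
  by rewrite lerD2r.
have := step N (leqnn _); rewrite /p divff ?gt_eqF// scale1r mul1r.
by rewrite addrC subrK.
Qed.

(* Otherwise the radial comparison with profile b' 0, applied around every center near x,
   makes w Hoelder continuous of order 4/3, hence constant, near x. *)
Lemma nondegeneracy A U w (B b l l1 : R) x : open A -> U `<=` A ->
  laplacian_ge A U w B -> 0 < b -> b < B -> 0 < l -> l < l1 ->
  (forall y, en (y - x) < l1 -> U y /\ {for y, continuous w}) ->
  exists2 y, en (y - x) <= l & w x + profile b 0 l <= w y.
Proof.
move=> oA UA W b0 bB l0 ll1 l1P; apply: contrapT => N.
have H y : en (y - x) <= l -> w y <= w x + profile b 0 l.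
  by move=> yl; rewrite leNgt; apply/negP => /ltW wy; apply: N; exists y.
pose b' := (b + B) / 2; have bb' : b < b' by rewrite /b'; lra.
have b'B : b' < B by rewrite /b'; lra.
clearbody b'; have b'0 := lt_trans b0 bb'.
have lt_l := profile_c0_lt b0 bb' l0.
(* Half of the gap pays for shrinking the radius from l to l', the other half for moving the centre
   from x to a nearby x'. *)
pose eta := (profile b' 0 l - profile b 0 l) / 2.
have eta0 : 0 < eta by rewrite divr_gt0// subr_gt0.
have [l' /andP[l'0 l'l] l'P] : exists2 l', 0 < l' < l & profile b 0 l + eta <= profile b' 0 l'.
  have := @continuous_profile _ b' 0 l => /cvgrPdist_lt /(_ _ eta0).
  move/nbhs_normP => [d /= d0 dP].
  have m0 : 0 < Num.min d l by rewrite lt_min d0.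
  have md : Num.min d l <= d by rewrite ge_min lexx.
  have ml : Num.min d l <= l by rewrite ge_min lexx orbT.
  exists (l - Num.min d l / 2); first by apply/andP; split; lra.
  have := dP (l - Num.min d l / 2); rewrite /= opprB addrC subrK gtr0_norm ?divr_gt0//.
  move=> /(_ _)/wrap[]; first by lra.
  by move/ltr_normlP => [_]; rewrite /eta; lra.
have wx : {for x, continuous w} by apply: (l1P x _).2; rewrite subrr en0 (lt_trans l0).
have /continuous_enP /(_ _ eta0)[d d0 dP] := wx.
pose d1 := Num.min d (Num.min (l - l') (l1 - l)).
have d10 : 0 < d1 by rewrite !lt_min d0 !subr_gt0 l'l.
have main x' : en (x' - x) < d1 -> forall y, en (y - x') <= l' ->
    w y <= w x' + profile b' 0 (en (y - x')).
  rewrite !lt_min => /and3P[xd xl xl1].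
  have near_x y : en (y - x') <= l' -> en (y - x) <= l.
    by move=> yl; apply: le_trans (en_triangle x' _ _) _; lra.
  apply: (radial_comparison oA UA W l'0) => [y /andP[_ /ltW /near_x yl]|||| |].
  - by apply: (l1P y _).1; exact: le_lt_trans ll1.
  - apply: within_continuous_sub => // y /= /near_x yl.
    by apply: (l1P y _).2; exact: le_lt_trans ll1.
  - exact: continuous_profile.
  - exact: profile0.
  - move=> rho /andP[rho0 _]; have pos : 0 < 3 * b' * rho + 0 by rewrite addr0 !mulr_gt0//.
    set s := cbrt (3 * b' * rho + 0); have s0 : 0 < s by exact: cbrt_gt0.
    exists s, ((b' + B) / 2 / s ^+ 2).
    have E : s ^+ 2 * ((b' + B) / 2 / s ^+ 2) = (b' + B) / 2 by field; rewrite gt_eqF.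
    rewrite E; split; first by lra.
    by apply: profile_expand => //; rewrite ?gt_eqF// -/s E; lra.
  - move=> y yl; have yl' : en (y - x') <= l' by rewrite yl.
    have := H y (near_x y yl'); have := dP x' xd => /ltr_normlP[].
    move: l'P; lra.
have wmax y : en (y - x) < d1 -> w y <= w x.
  move=> yd; apply/ler_addgt0Pr => e e0.
  have k0 : 0 < e / d1 by rewrite divr_gt0.
  have [r r0 rP] := profile_small b'0 k0.
  have m0 : 0 < Num.min (r / 2) l' by rewrite lt_min l'0 divr_gt0.
  (* Short steps gain at most k times their length since [profile b' 0] is sublinear at 0; as k is
     arbitrary, x is a local maximum of w and the constant 0 is an admissible test with Laplacian 0
     < B. *)
  apply: le_trans (chain_le (k := e / d1) m0 _) _.
    move=> p q px; rewrite le_min => /andP[qr ql].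
    apply: le_trans (main p (le_lt_trans px yd) q ql) _.
    by rewrite lerD2l; apply: rP; rewrite ?en_ge0//; lra.
  by rewrite lerD2l mulrAC ler_pdivrMr// ler_pM2l// ltW.
have : B <= infinity_laplacian (fun=> 0 : R) x.
  apply: W; first exact: C2_cst.
    by apply: (l1P x _).1; rewrite subrr en0 (lt_trans l0).
  apply/near_enP; exists d1 => // y /wmax; by rewrite !subr0.
by rewrite laplacian_cst leNgt (lt_trans b0 bB).
Qed.

(** The maximum of w over the ball of radius 2 e fixes a profile for b, the minimum of v a reversed
    profile for a'; these bound w and v at radius e, and comparing (y0, z0) with the pairs formed by
    x0 and the two extremal points yields the hypotheses of [profile_half]. The margins a < a' and b
    < B keep both radial functions strict. *)
Lemma strict_comparison_ball A w v x0 y0 z0 (a B e l1 : R) : open A ->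
  [set y | en (y - x0) < l1] `<=` A ->
  laplacian_ge A [set y | en (y - x0) < l1] w B ->
  laplacian_ge A [set y | en (y - x0) < l1] (fun y => - v y) (- a) ->
  (forall y, en (y - x0) < l1 -> {for y, continuous w} /\ {for y, continuous v}) ->
  0 < a -> a < B -> 0 < e -> 2 * e < l1 ->
  en (y0 - x0) <= e -> en (z0 - x0) <= e ->
  (forall y, en (y - x0) <= 2 * e -> w y - v x0 <= w y0 - v z0) ->
  (forall z, en (z - x0) <= 2 * e -> w x0 - v z <= w y0 - v z0) ->
  False.
Proof.
move=> oA UA W V wvc a0 aB e0 el1 y0e z0e maxw maxv.
pose a' := (2 * a + B) / 3; pose b := (a + 2 * B) / 3.
have [aa' a'b bB] : [/\ a < a', a' < b & b < B] by rewrite /a' /b; split; lra.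
clearbody a' b; have a'0 := lt_trans a0 aa'; have b0 := lt_trans a'0 a'b.
have e2 : 0 < 2 * e by rewrite mulr_gt0.
set U := [set y | _] in UA W V.
have KU y : en (y - x0) <= 2 * e -> U y by move=> ye; exact: le_lt_trans el1.
have inU y : 0 < en (y - x0) < 2 * e -> U y by move=> /andP[_ /ltW]; exact: KU.
have vNc y : en (y - x0) < l1 -> {for y, continuous (fun y => - v y)}.
  by move=> /wvc[_ vc]; exact: (continuousN vc).
have wK : {within [set y | en (y - x0) <= 2 * e], continuous w}.
  by apply: within_continuous_sub => // y /= /KU /wvc[].
have vK : {within [set y | en (y - x0) <= 2 * e], continuous (fun y => - v y)}.
  by apply: within_continuous_sub => // y /= /KU; exact: vNc.
have x0K : [set y | en (y - x0) <= 2 * e] x0 by rewrite /= subrr en0 ltW.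
have [y1 /= y1e y1M] := compact_max (ex_intro _ x0 x0K) (compact_en_ball (x := x0) (r := 2 * e)) wK.
have [z1 /= z1e z1M] := compact_max (ex_intro _ x0 x0K) (compact_en_ball (x := x0) (r := 2 * e)) vK.
(* Nondegeneracy makes the increment of w large enough to be matched with a nonnegative c2. *)
have [c2 c20 c2E] : exists2 c, 0 <= c & profile b c (2 * e) = w y1 - w x0.
  apply: profile_surj => //.
  have ndP y : en (y - x0) < l1 -> U y /\ {for y, continuous w}.
    by move=> yl; split => //; have [] := wvc y yl.
  have [y ye yP] := nondegeneracy oA UA W b0 bB e2 el1 ndP.
  by rewrite lerBrDl (le_trans yP)// y1M.
have wP : w y0 - w x0 <= profile b c2 e.
  suff wR : w y0 <= w x0 + profile b c2 (en (y0 - x0)).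
    by have := le_profile c2 (_ : b != 0) y0e; rewrite gt_eqF// => /(_ isT); lra.
  apply: (radial_comparison (l := 2 * e) oA UA W e2 inU wK).
  - exact: continuous_profile.
  - exact: profile0.
  - move=> rho /andP[rho0 _]; have pos : 0 < 3 * b * rho + c2 by rewrite ltr_wpDr// !mulr_gt0.
    set s := cbrt (3 * b * rho + c2); have s0 : 0 < s by exact: cbrt_gt0.
    exists s, ((b + B) / 2 / s ^+ 2).
    have E : s ^+ 2 * ((b + B) / 2 / s ^+ 2) = (b + B) / 2 by field; rewrite gt_eqF.
    rewrite E; split; first by lra.
    by apply: profile_expand => //; rewrite ?gt_eqF// -/s E; lra.
  - move=> y ye; rewrite c2E addrC subrK; apply: y1M; by rewrite ye.
  - by apply: le_trans y0e _; lra.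
have vP c1 : 0 <= c1 -> v x0 - v z1 <= profile a' c1 (2 * e) ->
    v x0 - v z0 <= profile a' c1 (2 * e) - profile a' c1 e.
  move=> c10 c1P; pose h r := profile (- a') (3 * a' * (2 * e) + c1) r.
  have hE r : h r = profile a' c1 (2 * e) - profile a' c1 (2 * e - r).
    by rewrite /h profile_reverse// gt_eqF.
  have -> : profile a' c1 (2 * e) - profile a' c1 e = h e.
    by rewrite hE; congr (_ - profile _ _ _); ring.
  have a'n : - a' != 0 by rewrite oppr_eq0 gt_eqF.
  suff : - v z0 <= - v x0 + h (en (z0 - x0)).
    by have := le_profile (3 * a' * (2 * e) + c1) a'n z0e; rewrite -/(h _) -/(h e); lra.
  apply: (radial_comparison (l := 2 * e) oA UA V e2 inU vK).
  - exact: continuous_profile.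
  - exact: profile0.
  - move=> rho /andP[rho0 rhoe].
    have pos : 0 < 3 * - a' * rho + (3 * a' * (2 * e) + c1).
      have -> : 3 * - a' * rho + (3 * a' * (2 * e) + c1) = 3 * a' * (2 * e - rho) + c1 by ring.
      by rewrite ltr_wpDr// !mulr_gt0// subr_gt0.
    set s := cbrt (3 * - a' * rho + (3 * a' * (2 * e) + c1)); have s0 : 0 < s by exact: cbrt_gt0.
    exists s, (- (a' + a) / 2 / s ^+ 2).
    have E : s ^+ 2 * (- (a' + a) / 2 / s ^+ 2) = - (a' + a) / 2 by field; rewrite gt_eqF.
    rewrite E; split; first by lra.
    by apply: profile_expand => //; rewrite -/s E; lra.
  - move=> y ye; rewrite hE subrr profile0 subr0.
    have y2e : en (y - x0) <= 2 * e by rewrite ye.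
    by have := z1M y y2e; lra.
  - by apply: le_trans z0e _; lra.
(* Against (y1, x0), maximality bounds w y1 - w y0 by v x0 - v z0; against (x0, z1), it bounds v z0
   - v z1 by w y0 - w x0. *)
have Q1 := maxw y1 y1e; have Q2 := maxv z1 z1e.
have H2 c1 : 0 <= c1 -> v x0 - v z1 <= profile a' c1 (2 * e) ->
    profile b c2 (2 * e) - profile b c2 e <= profile a' c1 (2 * e) - profile a' c1 e.
  by move=> c10 /(vP _ c10) ?; rewrite c2E; lra.
have [le_S|lt_S] := leP (profile a' 0 (2 * e)) (v x0 - v z1).
  have [c1 c10 c1E] := profile_surj a'0 e2 le_S.
  have c1le : v x0 - v z1 <= profile a' c1 (2 * e) by rewrite c1E.
  apply: (profile_half a'0 a'b c10 c20 e0 _ (H2 c1 c10 c1le)).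
  by have := vP c1 c10 c1le; rewrite c1E; lra.
(* Here v drops too little to be matched by a nonnegative c1. The choice c1 = 0 still bounds the
   drop from above, and the inequality at e follows from a' < b and 0 <= c2 alone. *)
apply: (profile_half a'0 a'b (lexx 0) c20 e0 _ (H2 0 (lexx 0) (ltW lt_S))).
apply: le_trans (profile_ge_c0 b0 c20 (ltW e0)).
exact: ltW (profile_c0_lt a'0 a'b e0).
Qed.
End Comparison.

(** * Monotonicity, homogeneity and continuity of the absorption term *)

Section Absorption.
Variables (R : realType) (gamma : R).
Hypothesis gamma0 : 0 <= gamma.
Implicit Types v w : R.
Local Notation f := (absorption gamma).

Lemma absorption_ge0 v : 0 <= f v.
Proof. by rewrite /absorption; case: ifP => // _; exact: powR_ge0. Qed.

Lemma absorption0 : f 0 = 0.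
Proof.
rewrite /absorption; case: eqVneq => [_|g0]; first by rewrite ltxx.
by rewrite maxxx powR0.
Qed.

Lemma absorption_gt0 v : 0 < v -> 0 < f v.
Proof.
move=> v0; rewrite /absorption; case: ifP => _; first by rewrite v0 ltr01.
by rewrite powR_gt0// lt_max v0.
Qed.

Lemma ler_absorption v w : v <= w -> f v <= f w.
Proof.
move=> vw; rewrite /absorption; case: ifP => _.
  by rewrite ler_nat; case: (ltP 0 v) => // v0; rewrite (lt_le_trans v0 vw).
have m0 (x : R) : 0 <= Num.max x 0 by rewrite le_max lexx orbT.
by rewrite ge0_ler_powR ?nnegrE// ge_max m0 le_max vw.
Qed.

Lemma absorptionZ (c v : R) : 0 < c -> f (c * v) = c `^ gamma * f v.
Proof.
move=> c0; rewrite /absorption; case: eqVneq => [->|g0].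
  by rewrite powRr0 mul1r pmulr_rgt0.
rewrite -powRM ?le_max ?lexx ?orbT// ?ltW//.
by rewrite maxr_pMr ?ltW// mulr0.
Qed.

Lemma absorption_continuous v e : 0 < v -> 0 < e ->
  exists2 d, 0 < d & forall w, `|w - v| < d -> `|f w - f v| < e.
Proof.
move=> v0 e0; have [g0|g0] := eqVneq gamma 0.
  exists v => // w wv; have w0 : 0 < w by move/ltr_normlP: wv => [? ?]; lra.
  by rewrite /absorption g0 eqxx v0 w0 subrr normr0.
have H : {for v, continuous (fun w : R => w `^ gamma)}.
  apply: differentiable_continuous; apply/derivable1_diffP.
  by apply: derivable_powR; rewrite in_itv/= v0.
have /cvgrPdist_lt /(_ _ e0) /nbhs_normP [d /= d0 dP] := H.
exists (Num.min d v); first by rewrite lt_min d0.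
move=> w; rewrite lt_min => /andP[wd wv].
have w0 : 0 < w by move/ltr_normlP: wv => [? ?]; lra.
rewrite /absorption (negPf g0) !(max_idPl _) ?ltW// distrC.
by apply: dP; rewrite /= distrC.
Qed.
End Absorption.

(** * Compactness tools and the comparison principle *)

Section Uniqueness.
Variables (R : realType) (n : nat).
Implicit Types (x y z : 'rV[R]_n) (K A : set 'rV[R]_n) (u v w : 'rV[R]_n -> R).

(** Compactness in near-covering form: as P holds for all small radii at all nearby points, one
    radius serves the whole of K. *)
Lemma compact_uniform K (P : R -> 'rV[R]_n -> Prop) : compact K ->
  (forall x, K x -> exists2 r : R, 0 < r &
     forall x', en (x' - x) < r -> forall i, 0 < i -> i < r -> P i x') ->
  exists2 d : R, 0 < d & forall x, K x -> P d x.
Proof.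
move=> /compact_near_coveringP cK H.
have : \forall i \near 0^'+, K `<=` P i.
  apply: cK => x Kx; have [r r0 rP] := H x Kx.
  exists ([set x' | en (x' - x) < r], [set i | 0 < i /\ i < r]).
    split; first by apply/near_enP; exists r.
    by near=> i; split.
  by move=> [x' i] /= [xr [i0 ir]]; exact: rP.
move=> H'; have [d [d0 dP]] : exists d : R, 0 < d /\ K `<=` P d.
  near (0 : R)^'+ => d; exists d; split => //.
  by near: d.
by exists d.
Unshelve. all: by end_near. Qed.

Lemma compact_unif_continuous K (f : 'rV[R]_n -> R) (e : R) : compact K ->
  {within K, continuous f} -> 0 < e ->
  exists2 d : R, 0 < d & forall x y, K x -> K y -> en (y - x) < d -> `|f y - f x| < e.
Proof.
move=> cK /within_continuous_enP fc e0.
suff H : exists2 d : R, 0 < d & forall x, K x -> K x -> forall y, K y -> en (y - x) < d -> `|f y - f x| < e.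
  by have [d d0 dP] := H; exists d => // x y Kx; exact: dP.
apply: (compact_uniform (P := fun i x => K x -> forall y, K y -> en (y - x) < i -> `|f y - f x| < e)) => //.
move=> x Kx; have [|r r0 rP] := fc x Kx (e / 2); first by rewrite divr_gt0.
exists (r / 2); first by rewrite divr_gt0.
move=> x' xr i i0 ir Kx' y Ky yi.
have yx : en (y - x) < r by apply: le_lt_trans (en_triangle x' _ _) _; lra.
have x'x : en (x' - x) < r by lra.
have := rP y Ky yx; have := rP x' Kx' x'x.
rewrite distrC => ? ?; have -> : f y - f x' = (f y - f x) + (f x - f x') by ring.
by apply: le_lt_trans (ler_normD _ _) _; lra.
Qed.

Lemma compact_pair_max K (w v : 'rV[R]_n -> R) (l : R) x : compact K -> K x -> 0 <= l ->
  {within K, continuous w} -> {within K, continuous v} ->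
  exists y0 z0, [/\ K y0, K z0, en (y0 - z0) <= l &
    forall y z, K y -> K z -> en (y - z) <= l -> w y - v z <= w y0 - v z0].
Proof.
move=> cK Kx l0 wc vc.
pose K2 : set ('rV[R]_n * 'rV[R]_n) := (K `*` K) `&` [set p | en (p.1 - p.2) <= l].
have cK2 : compact K2.
  apply: compact_closedI; first exact: compact_setX.
  have -> : [set p : 'rV[R]_n * 'rV[R]_n | en (p.1 - p.2) <= l] =
    (fun p => en (p.1 - p.2)) @^-1` [set t | t <= l] by [].
  apply: closed_comp => [p _|]; last exact: closed_le.
  apply: (continuous_comp (f := fun p : 'rV[R]_n * 'rV[R]_n => p.1 - p.2)).
    by apply: cvgB; [exact: cvg_fst|exact: cvg_snd].
  have := @continuous_en_sub R n 0 (p.1 - p.2).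
  by under eq_fun do rewrite subr0.
have fc : {within K2, continuous (fun p : 'rV[R]_n * 'rV[R]_n => w p.1 - v p.2)}.
  apply/subspace_continuousP => -[y z] [[/= Ky Kz] _]; apply/cvgrPdist_lt => e e0.
  have e2 : 0 < e / 2 by rewrite divr_gt0.
  move/within_continuous_enP: wc => /(_ y Ky _ e2)[r1 r10 r1P].
  move/within_continuous_enP: vc => /(_ z Kz _ e2)[r2 r20 r2P].
  rewrite near_withinE; exists ([set y' | en (y' - y) < r1], [set z' | en (z' - z) < r2]).
    by split; apply/near_enP; [exists r1|exists r2].
  move=> [y' z'] /= [yr zr] [[/= Ky' Kz'] _].
  rewrite /from_subspace/=; have := r1P y' Ky' yr; have := r2P z' Kz' zr.
  move=> /ltr_normlP[? ?] /ltr_normlP[? ?]; apply/ltr_normlP; split; lra.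
have K20 : K2 !=set0 by exists (x, x); split => //=; rewrite subrr en0.
have [[y0 z0]] := compact_EVT_max K20 cK2 fc.
rewrite inE => -[[/= Ky0 Kz0] yz0] H; exists y0, z0; split => // y z Ky Kz yz.
by apply: (H (y, z)); rewrite inE.
Qed.

Lemma compact_closure_bounded A : bounded_set A -> compact (closure A).
Proof.
move=> [M [_ MP]]; pose C : set 'rV[R]_n := [set x | `|x| <= M + 1].
have AC : A `<=` C by move=> x Ax; apply: MP => //; rewrite ltrDl.
have cC : closed C.
  have -> : C = (fun x => `|x|) @^-1` [set t | t <= M + 1] by [].
  by apply: closed_comp => [x _|]; [exact: norm_continuous|exact: closed_le].
apply: bounded_closed_compact; last exact: closed_closure.
exists (M + 1); split; first exact: num_real.
move=> N MN x /(closureS AC); rewrite -(closure_id C).1// => xC.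
exact: le_trans (ltW MN).
Qed.

(** A positive value of u - v survives the dilation of u by [lam] and cannot occur near the
    boundary; around the maximal pair the absorption terms are replaced by constants F < B, to which
    the strict comparison applies. *)
Theorem dirichlet_comparison (gamma : R) A u v : 0 <= gamma -> gamma < 3 ->
  open A -> bounded_set A ->
  {within closure A, continuous u} -> {within closure A, continuous v} ->
  (forall x, closure A x -> 0 <= v x) ->
  viscosity_subsolution gamma A u -> viscosity_supersolution gamma A v ->
  (forall x, boundary A x -> u x <= v x) ->
  forall x, closure A x -> u x <= v x.
Proof.
move=> g0 g3 oA bA uc vc v0 [_ us] [_ vs] uv xh Kxh; rewrite leNgt; apply/negP => mu_gt.
set K := closure A in uc vc v0 Kxh.
have cK : compact K by exact: compact_closure_bounded.
have AK : A `<=` K by exact: subset_closure.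
pose mu := u xh - v xh; have mu0 : 0 < mu by rewrite subr_gt0.
have [xm Kxm uM] := compact_max (ex_intro _ xh Kxh) cK uc.
set M := u xm in uM.
have M0 : 0 < M by have := uM _ Kxh; have := v0 _ Kxh; move: mu0; rewrite /mu; lra.
(* The dilation raises u by at most tau M = mu / 4, so w - v is at most mu / 4 on the boundary but
   at least mu at [xh]. *)
pose tau := mu / (4 * M).
have tau0 : 0 < tau by rewrite divr_gt0// mulr_gt0.
have tauM : tau * M = mu / 4 by rewrite /tau; field; rewrite gt_eqF.
pose lam := 1 + tau; have lam1 : 1 < lam by rewrite /lam ltrDl.
have lam0 : 0 < lam by rewrite (lt_trans ltr01).
pose w y := lam * u y.
have wc : {within K, continuous w}.
  by move=> y; apply: cvgM; [exact: cvg_cst|exact: uc].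
have uxh : 0 < u xh by have := v0 _ Kxh; move: mu0; rewrite /mu; lra.
have wxh : mu <= w xh - v xh.
  by rewrite /mu /w /lam lerD2r mulrDl mul1r lerDl mulr_ge0// ltW.
have wbd x : boundary A x -> w x - v x <= mu / 4.
  move=> bx; have Kx : K x by case: bx.
  have := uv x bx; have := uM x Kx; rewrite /w /lam -tauM.
  by move: tau0; nra.
have wvb x : K x -> ~ A x -> w x - v x <= mu / 4.
  by move=> Kx nA; apply: wbd; split => //; rewrite (interior_id A).1.
(* An oscillation of mu / 8 for each of w and v keeps w - v below mu / 2 near points where it is at
   most mu / 4, and costs at most mu / 4 out of mu near the maximal pair. *)
have mu8 : 0 < mu / 8 by rewrite divr_gt0.
have [d1 d10 d1P] := compact_unif_continuous cK wc mu8.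
have [d2 d20 d2P] := compact_unif_continuous cK vc mu8.
have [d3 d30 d3P] : exists2 d : R, 0 < d & forall x, K x -> K x -> mu / 2 <= w x - v x ->
    forall y, en (y - x) < d -> A y.
  apply: (compact_uniform (P := fun d x => K x -> mu / 2 <= w x - v x -> forall y, en (y - x) < d -> A y)) => //.
  move=> x Kx; have [Ax|nAx] := pselect (A x).
    have [r r0 rP] := open_enP oA Ax.
    exists (r / 2); first by rewrite divr_gt0.
    move=> x' xr i i0 ir _ _ y yi; apply: rP.
    by apply: le_lt_trans (en_triangle x' _ _) _; lra.
  exists (Num.min d1 d2); first by rewrite lt_min d10.
  move=> x'; rewrite lt_min => /andP[x1 x2] i _ _ Kx'.
  have := d1P x x' Kx Kx' x1; have := d2P x x' Kx Kx' x2.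
  have := wvb x Kx nAx.
  by move=> ? /ltr_normlP[? ?] /ltr_normlP[? ?]; lra.
pose d := Num.min d1 (Num.min d2 d3).
have d0 : 0 < d by rewrite !lt_min d10 d20.
have [dd1 dd2 dd3] : [/\ d <= d1, d <= d2 & d <= d3].
  by rewrite /d; split; rewrite !ge_min lexx ?orbT.
clearbody d; pose e := d / 10; have e0 : 0 < e by rewrite divr_gt0.
have [e1 e2 e3] : [/\ 9 * e < d1, 9 * e < d2 & 9 * e < d3] by rewrite /e; split; lra.
clearbody e.
have e20 : 0 <= 2 * e by rewrite mulr_ge0// ltW.
have [y0 [z0 [Ky0 Kz0 yz0 max0]]] := compact_pair_max cK Kxh e20 wc vc.
have mu_le : mu <= w y0 - v z0.
  by apply: le_trans wxh _; apply: max0 => //; rewrite subrr en0.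
have near_v : `|v y0 - v z0| < mu / 8 by apply: d2P => //; lra.
have By0 y : en (y - y0) < d3 -> A y.
  by apply: d3P => //; move/ltr_normlP: near_v => [? ?]; lra.
pose x0 := 2^-1 *: (y0 + z0).
have y0x0 : y0 - x0 = 2^-1 *: (y0 - z0).
  by apply/rowP => i; rewrite !mxE; lra.
have z0x0 : z0 - x0 = - (2^-1 *: (y0 - z0)).
  by apply/rowP => i; rewrite !mxE; lra.
have hn : `|2^-1 : R| = 2^-1 by rewrite gtr0_norm// invr_gt0.
have y0e : en (y0 - x0) <= e by rewrite y0x0 enZ hn; lra.
have z0e : en (z0 - x0) <= e by rewrite z0x0 enN enZ hn; lra.
have near_y0 y : en (y - x0) <= 3 * e -> en (y - y0) <= 4 * e.
  by move=> yx; apply: le_trans (en_triangle x0 _ _) _; rewrite (enB x0); lra.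
have near_z0 y : en (y - x0) <= 3 * e -> en (y - z0) <= 4 * e.
  by move=> yx; apply: le_trans (en_triangle x0 _ _) _; rewrite (enB x0); lra.
have inA y : en (y - x0) <= 3 * e -> A y by move/near_y0 => ?; apply: By0; lra.
have x0K : [set y | en (y - x0) <= 3 * e] x0 by rewrite /= subrr en0 mulr_ge0// ltW.
have wcA y : A y -> {for y, continuous w}.
  by apply: within_continuous_at => //; exact: continuous_subspaceW wc.
have vcA y : A y -> {for y, continuous v}.
  by apply: within_continuous_at => //; exact: continuous_subspaceW vc.
have nwc : {within [set y | en (y - x0) <= 3 * e], continuous (fun y => - w y)}.
  by apply: within_continuous_sub => y /= /inA /wcA wy; exact: (continuousN wy).
have [ym /= ymE ymP] : exists2 c, en (c - x0) <= 3 * e & forall y, en (y - x0) <= 3 * e -> w c <= w y.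
  have [c /= ce cP] := compact_max (f := fun y => - w y) (ex_intro _ x0 x0K) (compact_en_ball (x := x0) (r := 3 * e)) nwc.
  by exists c => // y /cP; rewrite lerN2.
(* The minimum m of w separates v <= m <= w on the ball, so by monotonicity the constant F bounds
   the absorption of v from above and that of w from below. *)
set m := w ym in ymP.
have vm y : en (y - x0) <= 3 * e -> v y <= m.
  move=> ye; have Ky := AK _ (inA _ ye).
  have : `|w ym - w y0| < mu / 8 by apply: d1P => //; [exact/AK/inA|have := near_y0 _ ymE; lra].
  have : `|v y - v z0| < mu / 8 by apply: d2P => //; have := near_z0 _ ye; lra.
  by rewrite -/m => /ltr_normlP[? ?] /ltr_normlP[? ?]; lra.
have m0 : 0 < m.
  have : `|w ym - w y0| < mu / 8 by apply: d1P => //; [exact/AK/inA|have := near_y0 _ ymE; lra].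
  by have := v0 _ Kz0; rewrite -/m => ? /ltr_normlP[? ?]; lra.
pose F := absorption gamma m; have F0 : 0 < F by exact: absorption_gt0.
(* From lam ^ 3 f (u) = lam ^ (3 - gamma) f (lam u), with f the absorption. *)
pose B := lam `^ (3 - gamma) * F.
have lamB : 1 < lam `^ (3 - gamma).
  have E : 1 `^ (3 - gamma) = 1 :> R by rewrite powR1.
  by rewrite -[X in X < _]E gt0_ltr_powR ?nnegrE ?subr_gt0// ltW.
have FB : F < B by rewrite /B ltr_pMl.
have UA : [set y | en (y - x0) < 3 * e] `<=` A by move=> y /= /ltW; exact: inA.
apply: (@strict_comparison_ball R n A w v x0 y0 z0 F B e (3 * e)) => //.
- move=> f x C /= xe M1; have Ax := UA _ xe.
  have linv0 : 0 < lam^-1 by rewrite invr_gt0.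
  have : 0 <= infinity_laplacian (fun y => lam^-1 * f y) x - absorption gamma (u x).
    apply: us; [exact: C2_scale|exact: Ax|].
    apply: filterS M1 => y; rewrite /w => H.
    rewrite -(ler_pM2l lam0) !mulrBr !mulrA divff ?gt_eqF// !mul1r; exact: H.
  rewrite (laplacian_scale _ oA C Ax) subr_ge0 exprVn ler_pdivlMl ?exprn_gt0//.
  apply: le_trans.
  have -> : lam ^+ 3 = lam `^ (3 - gamma) * lam `^ gamma.
    by rewrite -powRD ?subrK ?powR_mulrn ?ltW// gt_eqF// implybT.
  rewrite -mulrA -absorptionZ// ler_pM2l ?powR_gt0//.
  by apply: ler_absorption => //; apply: ymP; exact: ltW.
- move=> f x C /= xe M1; have Ax := UA _ xe.
  have : infinity_laplacian (fun y => - f y) x - absorption gamma (v x) <= 0.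
    apply: vs; [exact: C2_opp|exact: Ax|].
    by apply: filterS M1 => y; lra.
  rewrite (laplacian_opp oA C Ax).
  have := ler_absorption g0 (vm x (ltW xe)); rewrite -/F; lra.
- by move=> y /= /ltW /inA Ay; split; [exact: wcA|exact: vcA].
- by rewrite ltr_pM2r// ltr_nat.
- move=> y ye; apply: max0; [apply/AK/inA; lra|exact/AK/inA|exact: ye].
- move=> z ze; apply: max0; [exact/AK/inA|apply/AK/inA; lra|by rewrite enB].
Qed.
End Uniqueness.

(** * Concave radial barriers at interior and boundary points *)

Section Barriers.
Variables (R : realType) (n : nat).
Implicit Types (a l r rho : R) (x y z : 'rV[R]_n) (A : set 'rV[R]_n).

(** A cone bent down so that its slope falls from a at 0 to a / 2 at l; the bending makes the radial
    operator at most - a ^ 3 / (8 l) on [0, l]. *)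
Definition cone (a l r : R) : R := a * r - a / (4 * l) * r ^+ 2.

Lemma cone0 (a l : R) : cone a l 0 = 0.
Proof. by rewrite /cone; ring. Qed.

Lemma continuous_cone (a l : R) : continuous (cone a l).
Proof.
move=> r; apply: cvgB; apply: cvgM; try exact: cvg_cst; first exact: cvg_id.
by apply: (@cvg_expn R id); exact: cvg_id.
Qed.

Lemma continuous_cone_en a l z : continuous (fun y => cone a l (en (y - z))).
Proof.
move=> y; apply: (continuous_comp (f := fun y => en (y - z)) (g := cone a l)).
  exact: continuous_en_sub.
exact: continuous_cone.
Qed.

Lemma cone_bounds (a l r : R) : 0 < a -> 0 < l -> 0 <= r -> r <= l ->
  3 / 4 * a * r <= cone a l r <= a * r.
Proof.
move=> a0 l0 r0 rl; rewrite /cone.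
have -> : a / (4 * l) * r ^+ 2 = a * r * (r / l) / 4 by field; rewrite gt_eqF.
have rl1 : r / l <= 1 by rewrite ler_pdivrMr// mul1r.
have rl0 : 0 <= r / l by rewrite divr_ge0// ltW.
have ar : 0 <= a * r by rewrite mulr_ge0// ltW.
by apply/andP; split; nra.
Qed.

Lemma expands_cone (a l rho : R) : 0 < l ->
  expands (cone a l) rho (a - a * rho / (2 * l)) (- (a / (2 * l))).
Proof.
move=> l0; exists 1 => // r _; rewrite le_eqVlt; apply/orP; left; apply/eqP.
by rewrite /cone; field; rewrite gt_eqF.
Qed.

Lemma cone_laplacian (a l rho : R) : 0 < a -> 0 < l -> 0 <= rho -> rho <= l ->
  (a - a * rho / (2 * l)) ^+ 2 * - (a / (2 * l)) <= - (a ^+ 3 / (8 * l)).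
Proof.
move=> a0 l0 r0 rl; rewrite mulrN lerN2.
have -> : a ^+ 3 / (8 * l) = (a / 2) ^+ 2 * (a / (2 * l)) by field; rewrite gt_eqF.
have H : a / 2 <= a - a * rho / (2 * l).
  have -> : a - a * rho / (2 * l) = a * (1 - rho / l / 2) by field; rewrite gt_eqF.
  rewrite ler_pM2l//; suff : rho / l <= 1 by lra.
  by rewrite ler_pdivrMr ?mul1r.
by rewrite ler_pM2r ?divr_gt0 ?mulr_gt0// lerXn2r// nnegrE; lra.
Qed.

Lemma subsolution_lipschitz A (s : 'rV[R]_n -> R) x (M l : R) : open A ->
  laplacian_ge A A s 0 -> 0 < l -> 0 <= M ->
  (forall y, en (y - x) <= l -> A y /\ {for y, continuous s}) ->
  (forall y, A y -> 0 <= s y <= M) ->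
  forall y, en (y - x) <= l -> s y <= s x + 2 * ((M + 1) / l) * en (y - x).
Proof.
move=> oA S l0 M0 lA sM y yl.
set L := (M + 1) / l; have L0 : 0 < L by rewrite divr_gt0// ltr_wpDl.
have L20 : 0 < 2 * L by rewrite mulr_gt0.
have l20 : 0 < l / 2 by rewrite divr_gt0.
(* With these parameters the slope is 2 L (1 - r / l), positive before r = l, and the value at l is
   L l = M + 1, more than s can oscillate. *)
suff : s y <= s x + cone (2 * L) (l / 2) (en (y - x)).
  move/le_trans; apply; rewrite lerD2l /cone lerBlDr lerDl mulr_ge0 ?sqr_ge0//.
  by apply: divr_ge0; [exact: ltW|apply: mulr_ge0 => //; exact: ltW].
have Ax : A x by apply: (lA x _).1; rewrite subrr en0 ltW.
apply: (radial_comparison oA (@subset_refl _ A) S l0) => //.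
- by move=> z /andP[_ /ltW /lA[]].
- by apply: within_continuous_sub => z /= /lA[].
- exact: continuous_cone.
- exact: cone0.
- move=> rho /andP[rho0 rhol]; do 2 eexists; split; last exact: expands_cone.
  have -> : 2 * L - 2 * L * rho / (2 * (l / 2)) = 2 * L / l * (l - rho).
    by field; rewrite gt_eqF.
  rewrite mulrN oppr_lt0; apply: mulr_gt0; last by rewrite divr_gt0// mulr_gt0.
  by apply: exprn_gt0; rewrite mulr_gt0 ?divr_gt0 ?subr_gt0.
- move=> z zl; have Az : A z by apply: (lA z _).1; rewrite zl.
  have -> : cone (2 * L) (l / 2) l = M + 1 by rewrite /cone /L; field; rewrite gt_eqF.
  by have /andP[? ?] := sM z Az; have /andP[? ?] := sM x Ax; lra.
Qed.

(** The maximum of s minus the cone with vertex z lies on the boundary, since touching from above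
    inside A contradicts the negative Laplacian of the cone. The factors 3 / 4 and 1 are those of
    [cone_bounds]. *)
Lemma subsolution_le_barrier A (s phi : 'rV[R]_n -> R) z (a l e : R) : open A ->
  compact (closure A) -> laplacian_ge A A s 0 -> {within closure A, continuous s} ->
  boundary A z -> 0 < a -> 0 < l -> (forall x, closure A x -> en (x - z) <= l) ->
  (forall x, boundary A x -> s x <= phi x) ->
  (forall x, boundary A x -> phi x <= phi z + e + 3 / 4 * a * en (x - z)) ->
  forall x, closure A x -> s x <= phi z + e + a * en (x - z).
Proof.
move=> oA cK S sc [Kz nz] a0 l0 Kl sphi phie x Kx.
pose f y := s y - cone a l (en (y - z)).
have fc : {within closure A, continuous f}.
  exact: within_continuousB sc (continuous_subspaceT (@continuous_cone_en a l z)).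
have [c Kc cM] := compact_max (ex_intro _ z Kz) cK fc.
suff fce : f c <= phi z + e.
  have := cM x Kx; have /andP[_] := cone_bounds a0 l0 (en_ge0 _) (Kl x Kx).
  by rewrite {1}/f; lra.
have cl := Kl c Kc; have [Ac|nAc] := pselect (A c); last first.
  have bc : boundary A c by split => //; rewrite (interior_id A).1.
  have := sphi c bc; have := phie c bc.
  by have /andP[] := cone_bounds a0 l0 (en_ge0 _) cl; rewrite /f; lra.
exfalso; have c0 : 0 < en (c - z).
  rewrite lt_def en_ge0 andbT; apply/eqP => /en_eq0/eqP; rewrite subr_eq0 => /eqP cz.
  by apply: nz; rewrite (interior_id A).1// -cz.
have := radial_touch oA (@subset_refl _ A) S Ac c0 (expands_cone a (en (c - z)) l0).
move=> /(_ _)/wrap[].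
  have : nbhs c A by exact: open_nbhs_nbhs.
  by apply: filterS => y Ay; apply: cM; exact: subset_closure.
apply/negP; rewrite -ltNge; apply: le_lt_trans (cone_laplacian a0 l0 (en_ge0 _) cl) _.
by rewrite oppr_lt0 divr_gt0 ?exprn_gt0 ?mulr_gt0.
Qed.

Lemma laplacian_ge_sub gamma A u : 0 <= gamma -> viscosity_subsolution gamma A u ->
  laplacian_ge A A u 0.
Proof.
move=> g0 [_ H] f x C Ax /(H f x C Ax); rewrite subr_ge0; apply: le_trans.
exact: absorption_ge0.
Qed.

(** A maximum of two subsolutions: the constant 0, and k minus a cone, whose Laplacian is at least a
    ^ 3 / (8 l). The vertex, where the cone is not smooth, stays outside A. *)
Lemma lower_barrier_sub gamma A (k a l : R) z : 0 <= gamma -> open A -> ~ A z ->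
  0 < a -> 0 < l -> (forall x, A x -> en (x - z) <= l) ->
  absorption gamma k + 1 <= a ^+ 3 / (8 * l) ->
  viscosity_subsolution gamma A (fun x => Num.max (k - cone a l (en (x - z))) 0).
Proof.
move=> g0 oA nz a0 l0 Al ak.
pose b x := k - cone a l (en (x - z)).
have bc : continuous b.
  by move=> x; exact: (continuousB (@continuous_at_cst _ _ k x) (@continuous_cone_en a l z x)).
split.
  by apply: within_continuous_sub => x _; apply: continuous_max; [exact: bc|exact: continuous_at_cst].
move=> f x C Ax M; rewrite -/(b x) in M *.
have [b0|b0] := leP (b x) 0.
  rewrite absorption0// subr0 -(laplacian_cst 0 x).
  apply: (laplacian_le_local_max oA (@C2_cst _ _ A 0) C Ax).
  apply: filterS M => y; rewrite (max_idPr b0); apply: le_trans.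
  by rewrite lerD2r le_max lexx orbT.
have x0 : 0 < en (x - z).
  rewrite lt_def en_ge0 andbT; apply/eqP => /en_eq0/eqP; rewrite subr_eq0 => /eqP xz.
  by apply: nz; rewrite -xz.
have xl := Al x Ax.
set s := a - a * en (x - z) / (2 * l); set m := - (a / (2 * l)).
have s0 : 0 < s.
  have -> : s = a * (1 - en (x - z) / l / 2) by rewrite /s; field; rewrite gt_eqF.
  rewrite mulr_gt0// subr_gt0.
  suff : en (x - z) / l <= 1 by lra.
  by rewrite ler_pdivrMr ?mul1r.
have s20 : 0 < s ^+ 2 by rewrite exprn_gt0.
(* Multiplied by s ^ 2, this excess costs exactly the spare 1 in the hypothesis on a. *)
have mm : m < m + 1 / s ^+ 2 by rewrite ltrDl divr_gt0.
have [T [CT Tn Tx TL]] := radial_test oA Ax x0 mm (expands_cone a (en (x - z)) l0).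
have : infinity_laplacian (fun y => - T y) x <= infinity_laplacian f x.
  apply: (laplacian_le_local_max oA (C2_opp oA CT) C Ax).
  apply: filterS2 M Tn => y; rewrite Tx (max_idPl (ltW b0)) /b => M1 Ty.
  have : k - cone a l (en (y - z)) <= Num.max (k - cone a l (en (y - z))) 0 by rewrite le_max lexx.
  by move: M1 Ty; lra.
rewrite (laplacian_opp oA CT Ax) TL mulrDr mulrCA divff ?gt_eqF// mulr1.
have := cone_laplacian a0 l0 (en_ge0 _) xl; rewrite -/s -/m.
have : absorption gamma (b x) <= absorption gamma k.
  apply: ler_absorption => //; rewrite /b lerBlDr lerDl.
  by have /andP[+ _] := cone_bounds a0 l0 (en_ge0 _) xl; apply: le_trans; rewrite !mulr_ge0 ?en_ge0// ltW.
by move: ak; lra.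
Qed.

Lemma barrier_constants A (phi : 'rV[R]_n -> R) z (e k : R) : compact (closure A) ->
  {within boundary A, continuous phi} -> boundary A z -> 0 < e ->
  exists l a, [/\ 0 < l, 0 < a, forall x, closure A x -> en (x - z) <= l,
    k <= a ^+ 3 / (8 * l) &
    forall x, boundary A x -> `|phi x - phi z| <= e + 3 / 4 * a * en (x - z)].
Proof.
move=> cK phic bz e0; have Kz : closure A z by case: bz.
have [c _ cM] := compact_max (ex_intro _ z Kz) cK (continuous_subspaceT (@continuous_en_sub _ _ z)).
pose l := en (c - z) + 1; have l0 : 0 < l by rewrite ltr_wpDl// en_ge0.
have cB : compact (boundary A).
  have -> : boundary A = closure A `&` ~` A^° by rewrite /boundary setDE.
  by apply: compact_closedI => //; apply: open_closedC; exact: open_interior.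
have nc : {within boundary A, continuous (fun x => `|phi x - phi z|)}.
  apply/within_continuous_enP => x bx e1 e10.
  have [r r0 rP] := (within_continuous_enP _ _).1 phic x bx e1 e10.
  exists r => // y By yr; apply: le_lt_trans (rP y By yr).
  apply: le_trans (ler_dist_dist _ _) _.
  by have -> : phi y - phi z - (phi x - phi z) = phi y - phi x by ring.
have [d _ dM] := compact_max (ex_intro _ z bz) cB nc.
set M := `|phi d - phi z| in dM; have M0 : 0 <= M by exact: normr_ge0.
have [r r0 rP] := (within_continuous_enP _ _).1 phic z bz e e0.
(* The 1 gives a <= a ^ 3, the second term makes 3 / 4 * a * r at least M where continuity of phi at
   z no longer helps, and the third makes a / (8 l) at least k. *)
pose a := 1 + 4 * M / (3 * r) + 8 * l * `|k|.
have a1 : 1 <= a.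
  by rewrite /a -addrA lerDl addr_ge0// ?divr_ge0 ?mulr_ge0// ltW.
have a0 : 0 < a by rewrite (lt_le_trans ltr01).
exists l, a; split => //.
- by move=> x /cM; rewrite /l => /le_trans; apply; rewrite lerDl.
- rewrite ler_pdivlMr ?mulr_gt0//; apply: (@le_trans _ _ a).
    apply: (@le_trans _ _ (8 * l * `|k|)).
      by rewrite mulrC ler_pM2l ?mulr_gt0// ler_norm.
    by rewrite /a lerDr addr_ge0// divr_ge0 ?mulr_ge0// ltW.
  by rewrite -[leLHS]expr1 ler_weXn2l.
- move=> x bx; have [xr|xr] := ltP (en (x - z)) r.
    apply: le_trans (ltW (rP x bx xr)) _; rewrite lerDl.
    by rewrite !mulr_ge0 ?en_ge0// ltW.
  apply: le_trans (dM x bx) _.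
  apply: (@le_trans _ _ (3 / 4 * a * r)).
    have : 4 * M / (3 * r) <= a.
      by rewrite /a addrAC lerDr addr_ge0 ?mulr_ge0// ltW.
    by rewrite ler_pdivrMr ?mulr_gt0//; lra.
  apply: (@le_trans _ _ (3 / 4 * a * en (x - z))); last by rewrite lerDr ltW.
  by rewrite ler_pM2l// mulr_gt0.
Qed.

(** A point of the closure where one coordinate is largest cannot be in A. Such a point anchors the
    barriers that make the Perron class nonempty and bounded. *)
Lemma boundary_nonempty A : (0 < n)%N -> open A -> bounded_set A -> A !=set0 ->
  boundary A !=set0.
Proof.
move=> n0 oA bA [x Ax]; pose i : 'I_n := Ordinal n0.
have cK := compact_closure_bounded bA.
have Kx : closure A x by exact: subset_closure.
have ic : {within closure A, continuous (fun y : 'rV[R]_n => y 0 i)}.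
  by apply: continuous_subspaceT; exact: coord_continuous.
have [c Kc cM] := compact_max (ex_intro _ x Kx) cK ic.
exists c; split => //; rewrite (interior_id A).1// => Ac.
have [r r0 rP] := open_enP oA Ac.
have : A (c + (r / 2) *: delta_mx 0 i).
  apply: rP; rewrite addrAC subrr add0r.
  have -> : en ((r / 2) *: delta_mx 0 i : 'rV[R]_n) = r / 2.
    rewrite enZ gtr0_norm ?divr_gt0// /en /sqn (bigD1 i)//= big1 ?addr0.
      by rewrite mxE !eqxx expr1n sqrtr1 mulr1.
    by move=> j ji; rewrite mxE (negPf ji) andbF expr0n.
  lra.
move=> /subset_closure /cM; rewrite !mxE !eqxx mulr1.
by apply/negP; rewrite -ltNge ltrDl divr_gt0.
Qed.
End Barriers.

(** * Perron's method *)

Section Perron.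
Variables (R : realType) (n : nat) (gamma : R) (A : set 'rV[R]_n) (phi : 'rV[R]_n -> R).
Hypotheses (n_gt0 : (0 < n)%N) (gamma_ge0 : 0 <= gamma) (A_open : open A)
  (A_bounded : bounded_set A) (A_nonempty : A !=set0)
  (phi_cont : {within boundary A, continuous phi})
  (phi_ge0 : forall x, boundary A x -> 0 <= phi x).
Implicit Types (x y z : 'rV[R]_n) (s f : 'rV[R]_n -> R).

(** Members are continuous up to the boundary, so no semicontinuous envelopes arise; the supremum
    turns out to be a member itself. *)
Definition perron_class s := [/\ {within closure A, continuous s},
  forall x, closure A x -> 0 <= s x, viscosity_subsolution gamma A s &
  forall x, boundary A x -> s x <= phi x].

(** [sup] has a default value on empty or unbounded sets, so nonemptiness and boundedness of the
    class must be settled before it is used. *)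
Definition perron x : R := sup [set s x | s in perron_class].

Let closure_compact : compact (closure A) := compact_closure_bounded A_bounded.

Let A_sub_closure : A `<=` closure A := @subset_closure _ A.

Let boundaryE x : boundary A x <-> closure A x /\ ~ A x.
Proof. by rewrite /boundary (interior_id A).1. Qed.

(** One slope a serves all members, so the bound passes to the supremum. *)
Lemma perron_class_upper z e : boundary A z -> 0 < e ->
  exists2 a, 0 < a & forall s x, perron_class s -> closure A x ->
    s x <= phi z + e + a * en (x - z).
Proof.
move=> bz e0.
have [l [a [l0 a0 Kl _ pe]]] := barrier_constants 0 closure_compact phi_cont bz e0.
exists a => // s x [sc _ ss sphi] Kx.
apply: (subsolution_le_barrier A_open closure_compact _ sc bz a0 l0 Kl sphi _ Kx).
  exact: laplacian_ge_sub ss.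
by move=> y /pe /ler_normlP[_]; lra.
Qed.

Lemma perron_class_lower z e : boundary A z -> 0 < e ->
  exists2 a, 0 < a & exists2 s, perron_class s &
    forall x, closure A x -> phi z - e - a * en (x - z) <= s x.
Proof.
move=> bz e0.
have [l [a [l0 a0 Kl ak pe]]] :=
  barrier_constants (absorption gamma (phi z - e) + 1) closure_compact phi_cont bz e0.
have [Kz nz] := (boundaryE z).1 bz.
exists a => //; exists (fun x => Num.max (phi z - e - cone a l (en (x - z))) 0); last first.
  move=> x Kx; rewrite le_max; apply/orP; left.
  by have /andP[_] := cone_bounds a0 l0 (en_ge0 _) (Kl x Kx); lra.
have sub := lower_barrier_sub gamma_ge0 A_open nz a0 l0 (fun x Ax => Kl x (A_sub_closure Ax)) ak.
split=> //.
- apply: within_continuous_sub => x _; apply: continuous_max; last exact: continuous_at_cst.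
  exact: (continuousB (@continuous_at_cst _ _ (phi z - e) x) (@continuous_cone_en _ _ a l z x)).
- by move=> x _; rewrite le_max lexx orbT.
- move=> x bx; rewrite ge_max phi_ge0// andbT.
  have [Kx _] := (boundaryE x).1 bx.
  have /andP[] := cone_bounds a0 l0 (en_ge0 _) (Kl x Kx).
  by have /ler_normlP[] := pe x bx; lra.
Qed.

Lemma perron_class_nonempty : exists s, perron_class s.
Proof.
have [z bz] := boundary_nonempty n_gt0 A_open A_bounded A_nonempty.
by have [a _ [s Ss _]] := perron_class_lower bz ltr01; exists s.
Qed.

Lemma perron_class_bounded : exists2 M, 0 <= M &
  forall s x, perron_class s -> closure A x -> s x <= M.
Proof.
have [z bz] := boundary_nonempty n_gt0 A_open A_bounded A_nonempty.
have [Kz _] := (boundaryE z).1 bz.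
have [a a0 H] := perron_class_upper bz ltr01.
have [c _ cM] := compact_max (ex_intro _ z Kz) closure_compact (continuous_subspaceT (@continuous_en_sub _ _ z)).
exists (phi z + 1 + a * en (c - z)).
  by rewrite !addr_ge0 ?phi_ge0// mulr_ge0 ?en_ge0// ltW.
move=> s x Ss Kx; apply: le_trans (H s x Ss Kx) _.
by rewrite lerD2l ler_pM2l// cM.
Qed.

Lemma perron_ge s x : perron_class s -> closure A x -> s x <= perron x.
Proof.
move=> Ss Kx; have [M _ MP] := perron_class_bounded.
apply: ub_le_sup; last by exists s.
by exists M => _ [t St <-]; exact: MP.
Qed.

Lemma perron_le x b : (forall s, perron_class s -> s x <= b) -> perron x <= b.
Proof.
move=> H; apply: ge_sup; last by move=> _ [s Ss <-]; exact: H.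
by have [s Ss] := perron_class_nonempty; exists (s x); exists s.
Qed.

Lemma perron_adherent x e : closure A x -> 0 < e ->
  exists2 s, perron_class s & perron x - e < s x.
Proof.
move=> Kx e0; apply: contrapT => N.
have : perron x <= perron x - e.
  by apply: perron_le => s Ss; rewrite leNgt; apply/negP => H; apply: N; exists s.
by apply/negP; rewrite -ltNge ltrBlDr ltrDl.
Qed.

Lemma perron_ge0 x : closure A x -> 0 <= perron x.
Proof.
move=> Kx; have [s Ss] := perron_class_nonempty.
by apply: le_trans (perron_ge Ss Kx); case: Ss => _ + _ _; apply.
Qed.

Lemma perron_boundary z : boundary A z -> perron z = phi z.
Proof.
move=> bz; apply/eqP; rewrite eq_le; apply/andP; split.
  by apply: perron_le => s [_ _ _]; exact.
apply/ler_addgt0Pr => e e0; have [Kz _] := (boundaryE z).1 bz.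
have [a _ [s Ss sP]] := perron_class_lower bz e0.
have := sP z Kz; have := perron_ge Ss Kz; rewrite subrr en0 mulr0; lra.
Qed.

Lemma perron_lipschitz l : 0 < l ->
  exists2 L, 0 < L & forall x, (forall y, en (y - x) <= l -> A y) ->
  forall y, en (y - x) <= l -> perron y <= perron x + L * en (y - x).
Proof.
move=> l0; have [M M0 MP] := perron_class_bounded.
exists (2 * ((M + 1) / l)); first by rewrite mulr_gt0// divr_gt0// ltr_wpDl.
move=> x xA y yl; apply: perron_le => s Ss; have [sc s0 ss _] := Ss.
have Kx : closure A x by apply/A_sub_closure/xA; rewrite subrr en0 ltW.
apply: (@le_trans _ _ (s x + 2 * ((M + 1) / l) * en (y - x))).
  apply: (subsolution_lipschitz A_open (laplacian_ge_sub gamma_ge0 ss) l0 M0) => //.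
    move=> t /xA At; split => //.
    by apply: (within_continuous_at A_open _ At); exact: continuous_subspaceW sc.
  by move=> t /A_sub_closure Kt; rewrite s0//= MP.
by rewrite lerD2r; exact: perron_ge.
Qed.

Lemma perron_continuous : {within closure A, continuous perron}.
Proof.
apply/within_continuous_enP => x Kx e e0.
have [Ax|nAx] := pselect (A x).
  have [r r0 rP] := open_enP A_open Ax.
  have l0 : 0 < r / 3 by rewrite divr_gt0.
  have lx y : en (y - x) <= r / 3 -> A y by move=> yr; apply: rP; lra.
  have [L L0 LP] := perron_lipschitz l0.
  exists (Num.min (r / 3) (e / L)); first by rewrite lt_min l0 divr_gt0.
  move=> y _; rewrite lt_min => /andP[yl ye].
  have ly t : en (t - y) <= r / 3 -> A t.
    by move=> ty; apply: rP; apply: le_lt_trans (en_triangle y _ _) _; lra.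
  have H1 := LP x lx y (ltW yl).
  have H2 : perron x <= perron y + L * en (y - x).
    by rewrite -(enB x); apply: LP => //; rewrite enB ltW.
  move: ye; rewrite ltr_pdivlMr// mulrC => ye.
  by apply/ltr_normlP; split; lra.
have bx : boundary A x by apply/boundaryE.
have e2 : 0 < e / 2 by rewrite divr_gt0.
have [a1 a10 up] := perron_class_upper bx e2.
have [a2 a20 [s Ss sP]] := perron_class_lower bx e2.
exists (Num.min (e / 2 / a1) (e / 2 / a2)); first by rewrite lt_min !divr_gt0.
move=> y Ky; rewrite lt_min !ltr_pdivlMr// [_ * a1]mulrC [_ * a2]mulrC => /andP[y1 y2].
rewrite (perron_boundary bx).
have H1 : perron y <= phi x + e / 2 + a1 * en (y - x) by apply: perron_le => t St; exact: up.
have H2 := le_trans (sP y Ky) (perron_ge Ss Ky).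
by apply/ltr_normlP; split; lra.
Qed.

(** |y - Y| ^ 4 has vanishing first and second derivatives at Y, so it makes the contact at Y strict
    at no cost in the Laplacian there. *)
Lemma quartic_perturbation f Y (c : R) : C2_on A f -> A Y ->
  C2_on A (fun y => f y + c * sqn (y - Y) ^+ 2) /\
  infinity_laplacian (fun y => f y + c * sqn (y - Y) ^+ 2) Y = infinity_laplacian f Y.
Proof.
move=> /C2_jet2 J AY; have J' := jet2_add J (jet2_quad 0 0 c A_open (@jet2_sqn R n A Y)).
have E : (fun y => f y + (0 + 0 * sqn (y - Y) + c * sqn (y - Y) ^+ 2)) =
    (fun y => f y + c * sqn (y - Y) ^+ 2) by apply/funext => y; ring.
rewrite E in J'; split; first exact: jet2_C2 J'.
rewrite (jet2_laplacian A_open J' AY); apply: eq_bigr => i _; apply: eq_bigr => j _.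
have -> : sqn (Y - Y) = 0 by rewrite -en_sqr subrr en0 expr0n.
by rewrite !mxE; ring.
Qed.

(** A member s almost attaining the supremum at Y is touched from above by a translate of the strict
    test P at some c near Y; the inequality for s at c contradicts the assumed strict failure, which
    persists near Y. *)
Lemma perron_subsolution : viscosity_subsolution gamma A perron.
Proof.
split; first exact: continuous_subspaceW A_sub_closure perron_continuous.
move=> f Y C AY M; have KY := A_sub_closure AY.
have uY0 := perron_ge0 KY.
rewrite subr_ge0 leNgt; apply/negP => lt_f.
(* At a zero of [perron], f minus a constant lies above 0 and touches it, so its Laplacian is
   nonnegative. Positivity is what [absorption_continuous] requires. *)
have uY : 0 < perron Y.
  rewrite lt_def uY0 andbT; apply/eqP => u0; move: lt_f.
  rewrite u0 absorption0// ltNge -(laplacian_cst 0 Y); apply/negP/negPn.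
  apply: (laplacian_le_local_max A_open (@C2_cst _ _ A 0) C AY).
  have : nbhs Y A by exact: open_nbhs_nbhs.
  by apply: filterS2 M => y + /A_sub_closure /perron_ge0; rewrite u0; lra.
have gap : 0 < absorption gamma (perron Y) - infinity_laplacian f Y by rewrite subr_gt0.
have [th th0 thP] := absorption_continuous gamma uY gap.
pose t := th / 2; have t0 : 0 < t by rewrite divr_gt0.
have lt_F : infinity_laplacian f Y < absorption gamma (perron Y - t).
  have := thP (perron Y - t); rewrite addrAC subrr add0r normrN gtr0_norm// => /(_ _)/wrap[].
    by rewrite /t; lra.
  by move/ltr_normlP => [? ?]; lra.
have [CP LP] := quartic_perturbation 1 C AY.
set P := fun y => f y + 1 * sqn (y - Y) ^+ 2 in CP LP.
have PY : P Y = f Y by rewrite /P -en_sqr subrr en0; ring.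
have [r r0 rP] : exists2 r, 0 < r & forall y, en (y - Y) < r ->
    [/\ infinity_laplacian P y < absorption gamma (perron Y - t), P Y - t / 2 < P y,
        A y & perron y - f y <= perron Y - f Y].
  apply/near_enP.
  have N1 : \forall y \near Y, infinity_laplacian P y < absorption gamma (perron Y - t).
    by apply: (cvgr_lt _ (continuous_laplacian CP AY)); rewrite LP.
  have N2 : \forall y \near Y, P Y - t / 2 < P y.
    by apply: (cvgr_gt _ (C2_continuous A_open CP AY)); rewrite ltrBlDr ltrDl divr_gt0.
  have N3 : nbhs Y A by exact: open_nbhs_nbhs.
  apply: filterS2 (filterI N1 N2) (filterI N3 M).
  by move=> y [? ?] [? ?]; split.
pose q := r / 2; have q0 : 0 < q by rewrite divr_gt0.
have qr y : en (y - Y) <= q -> en (y - Y) < r by rewrite /q; lra.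
(* The bound q ^ 4 keeps the contact point off the sphere of radius q; t / 2 keeps s there above
   perron Y - t. *)
have e0 : 0 < Num.min (q ^+ 4) (t / 2) by rewrite lt_min exprn_gt0// divr_gt0.
have [s Ss] := perron_adherent KY e0.
set d := Num.min _ _; have [d1 d2] : d <= q ^+ 4 /\ d <= t / 2 by rewrite /d !ge_min !lexx orbT.
move=> sY; have [sc s0 [_ ss] _] := Ss.
have QK : [set y | en (y - Y) <= q] Y by rewrite /= subrr en0 ltW.
have sAc y : A y -> {for y, continuous s}.
  by apply: within_continuous_at => //; exact: continuous_subspaceW sc.
have gc : {within [set y | en (y - Y) <= q], continuous (fun y => s y - P y)}.
  apply: within_continuous_sub => y /= /qr /rP[_ _ Ay _].
  exact: (continuousB (sAc y Ay) (C2_continuous A_open CP Ay)).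
have [c /= cq cM] := compact_max (ex_intro _ Y QK) (compact_en_ball (x := Y) (r := q)) gc.
have [L1 L2 Ac L3] := rP c (qr c cq).
have cY := cM Y QK; rewrite PY in cY.
have sc_le := perron_ge Ss (A_sub_closure Ac).
have cq' : en (c - Y) < q.
  rewrite lt_def cq andbT; apply/eqP => qc.
  have : P c = f c + q ^+ 4 by rewrite /P -en_sqr -qc; ring.
  by move: cY sY L3 sc_le d1; lra.
have : 0 <= infinity_laplacian P c - absorption gamma (s c).
  apply: ss => //; apply/near_enP; exists (q - en (c - Y)); first by rewrite subr_gt0.
  move=> y yc; apply: cM; apply/ltW; apply: le_lt_trans (en_triangle c _ _) _.
  by rewrite -ltrBrDr.
have : absorption gamma (perron Y - t) <= absorption gamma (s c).
  by apply: ler_absorption => //; rewrite -PY in cY; move: cY sY L2 d2; lra.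
by move: L1; lra.
Qed.

Lemma perron_in_class : perron_class perron.
Proof.
split; [exact: perron_continuous|exact: perron_ge0|exact: perron_subsolution|].
by move=> x /perron_boundary ->.
Qed.

(** Otherwise P, made strict by a quartic and slightly raised, could be joined to [perron] near Y to
    give a larger member of the class. The margin t bounds the absorption of the raised values by
    monotonicity alone, as continuity fails at 0 when [gamma = 0]. *)
Lemma no_bump P Y (t : R) : C2_on A P -> A Y -> P Y = perron Y ->
  (\forall y \near Y, P y <= perron y) -> 0 < t ->
  infinity_laplacian P Y <= absorption gamma (perron Y + t).
Proof.
move=> C AY PY PM t0; rewrite leNgt; apply/negP => lt_F.
have KY := A_sub_closure AY.
have [CQ LQ] := quartic_perturbation (-1) C AY.
set Q := fun y => P y + -1 * sqn (y - Y) ^+ 2 in CQ LQ.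
have QE y : Q y = P y - en (y - Y) ^+ 4 by rewrite /Q -en_sqr; ring.
have QY : Q Y = perron Y by rewrite QE subrr en0 PY; ring.
have [uc u0 [_ us] ub] := perron_in_class.
have uAc y : A y -> {for y, continuous perron}.
  by apply: within_continuous_at => //; exact: continuous_subspaceW uc.
have [r r0 rP] : exists2 r, 0 < r & forall y, en (y - Y) < r ->
    [/\ absorption gamma (perron Y + t) < infinity_laplacian Q y, Q y < perron Y + t / 2,
        A y & P y <= perron y].
  apply/near_enP.
  have N1 : \forall y \near Y, absorption gamma (perron Y + t) < infinity_laplacian Q y.
    by apply: (cvgr_gt _ (continuous_laplacian CQ AY)); rewrite LQ.
  have N2 : \forall y \near Y, Q y < perron Y + t / 2.
    by apply: (cvgr_lt _ (C2_continuous A_open CQ AY)); rewrite QY ltrDl divr_gt0.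
  have N3 : nbhs Y A by exact: open_nbhs_nbhs.
  apply: filterS2 (filterI N1 N2) (filterI N3 PM).
  by move=> y [? ?] [? ?]; split.
pose q := r / 2; have q0 : 0 < q by rewrite divr_gt0.
have qr : q < r by rewrite /q; lra.
pose d := Num.min (q ^+ 4) (t / 2).
have d0 : 0 < d by rewrite lt_min exprn_gt0// divr_gt0.
have [d1 d2] : d <= q ^+ 4 /\ d <= t / 2 by rewrite /d !ge_min !lexx orbT.
clearbody d.
(* Since d <= q ^ 4, Q + d is already below [perron] for q <= |y - Y| < r. So s is the maximum
   throughout the larger ball and [perron] outside the smaller one, and the overlap gives continuity
   and the local tests. *)
pose s y := if en (y - Y) < q then Num.max (perron y) (Q y + d) else perron y.
have s_ge y : perron y <= s y by rewrite /s; case: ifP => // _; rewrite le_max lexx.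
have s_max y : en (y - Y) < r -> s y = Num.max (perron y) (Q y + d).
  move=> yr; rewrite /s; case: ltP => // qy; apply/esym/max_idPl.
  have [_ _ _ L] := rP y yr; rewrite QE.
  have : q ^+ 4 <= en (y - Y) ^+ 4 by rewrite lerXn2r ?nnegrE ?en_ge0// ltW.
  by move: L d1; lra.
have s_out y : q <= en (y - Y) -> s y = perron y by rewrite /s leNgt => /negbTE ->.
suff Ss : perron_class s.
  have := perron_ge Ss KY; rewrite s_max ?subrr ?en0// QY ge_max => /andP[_].
  by apply/negP; rewrite -ltNge ltrDl.
have s_cont : {within closure A, continuous s}.
  apply/within_continuous_enP => x Kx e e0.
  have [xr|rx] := ltP (en (x - Y)) r.
    have [_ _ Ax _] := rP x xr.
    have mc : {for x, continuous (fun y => Num.max (perron y) (Q y + d))}.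
      apply: continuous_max; first exact: uAc.
      apply: continuous_atD; last exact: continuous_at_cst.
      exact: C2_continuous CQ Ax.
    have [r1 r10 r1P] := (continuous_enP _ _).1 mc e e0.
    exists (Num.min r1 (r - en (x - Y))); first by rewrite lt_min r10 subr_gt0.
    move=> y _; rewrite lt_min => /andP[y1 y2]; rewrite !s_max//; first exact: r1P.
    by apply: le_lt_trans (en_triangle x _ _) _; lra.
  have [r1 r10 r1P] := (within_continuous_enP _ _).1 uc x Kx e e0.
  exists (Num.min r1 (r - q)); first by rewrite lt_min r10 subr_gt0.
  move=> y Ky; rewrite lt_min => /andP[y1 y2]; rewrite !s_out; first exact: r1P.
    by lra.
  by have := en_triangle y x Y; rewrite (enB x y); lra.
split => //.
- by move=> x Kx; apply: le_trans (u0 x Kx) (s_ge x).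
- split; first exact: continuous_subspaceW A_sub_closure s_cont.
  move=> f x Cf Ax M.
  have [E|E] := eqVneq (s x) (perron x).
    rewrite E; apply: us => //; apply: filterS M => y.
    by rewrite E; have := s_ge y; lra.
  have xq : en (x - Y) < q by rewrite ltNge; apply/negP => /s_out E'; rewrite E' eqxx in E.
  have xr := lt_trans xq qr; have [L1 L2 _ _] := rP x xr.
  have sx : s x = Q x + d.
    by move: E; rewrite s_max//; case: leP => // _; rewrite eqxx.
  have le_L : infinity_laplacian Q x <= infinity_laplacian f x.
    apply: (laplacian_le_local_max A_open CQ Cf Ax).
    have N : \forall y \near x, en (y - Y) < r.
      apply/near_enP; exists (r - en (x - Y)); first by rewrite subr_gt0.
      by move=> y yx; apply: le_lt_trans (en_triangle x _ _) _; rewrite -ltrBrDr.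
    apply: filterS2 M N => y + yr; rewrite sx s_max//.
    have : Q y + d <= Num.max (perron y) (Q y + d) by rewrite le_max lexx orbT.
    by lra.
  have : absorption gamma (s x) <= absorption gamma (perron Y + t).
    by apply: ler_absorption => //; rewrite sx; lra.
  by move: L1 le_L; lra.
- move=> x bx; have [Kx nAx] := (boundaryE x).1 bx; rewrite s_out; first exact: ub.
  by rewrite leNgt; apply/negP => xq; have [_ _ Ax _] := rP x (lt_trans xq qr).
Qed.

(* Where u vanishes, P / 2 + K P ^ 2 stays below max(P, 0) <= u near the zero, and its infinity
   Laplacian there is arbitrarily large. *)
Lemma perron_supersolution : viscosity_supersolution gamma A perron.
Proof.
split; first exact: continuous_subspaceW A_sub_closure perron_continuous.
move=> f Y C AY M; have KY := A_sub_closure AY.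
have uY0 := perron_ge0 KY.
rewrite subr_le0 leNgt; apply/negP => lt_f.
have Jf := C2_jet2 C.
pose P y := perron Y - f Y + 1 * f y + 0 * f y ^+ 2.
have PE y : P y = perron Y - f Y + f y by rewrite /P; ring.
have J := jet2_quad (perron Y - f Y) 1 0 A_open Jf.
have CP : C2_on A P by exact: jet2_C2 J.
have LP : infinity_laplacian P Y = infinity_laplacian f Y.
  by rewrite (laplacian_quad _ _ _ A_open Jf AY); ring.
have PY : P Y = perron Y by rewrite PE subrK.
have PM : \forall y \near Y, P y <= perron y.
  by apply: filterS M => y; rewrite PE; lra.
have [uY|uY] := ltP 0 (perron Y).
  have gap : 0 < infinity_laplacian f Y - absorption gamma (perron Y) by rewrite subr_gt0.
  have [th th0 thP] := absorption_continuous gamma uY gap.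
  have th2 : 0 < th / 2 by rewrite divr_gt0.
  have := no_bump CP AY PY PM th2; rewrite LP.
  have := thP (perron Y + th / 2); rewrite addrAC subrr add0r gtr0_norm// => /(_ _)/wrap[].
    by lra.
  by move/ltr_normlP => [? ?]; lra.
have {uY}u0 : perron Y = 0 by apply/eqP; rewrite eq_le uY uY0.
rewrite u0 absorption0// in lt_f.
have JP := C2_jet2 CP.
set g := \sum_i partial i P Y ^+ 2.
have g0 : 0 < g.
  have ge0 i : 0 <= partial i P Y ^+ 2 by exact: sqr_ge0.
  rewrite lt_def sumr_ge0 ?andbT//; apply/eqP => g0.
  have p0 i : partial i P Y = 0.
    apply/eqP; rewrite -sqrf_eq0; apply/eqP.
    by have /psumr_eq0P := g0 => /(_ (fun i _ => ge0 i)); exact.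
  by move: lt_f; rewrite -LP /infinity_laplacian big1 ?ltxx// => i _; rewrite big1// => j _; rewrite p0 !mul0r.
(* Chosen so that the term K g ^ 2 / 2 in the Laplacian of Q at Y equals [absorption gamma 1 + 1],
   above the level that [no_bump] allows for t = 1. *)
pose K := 2 * (absorption gamma 1 + 1) / g ^+ 2.
have F1 : 0 <= absorption gamma 1 by exact: absorption_ge0.
have K0 : 0 < K by rewrite divr_gt0 ?exprn_gt0// mulr_gt0// ltr_wpDl.
pose Q y := 0 + 2^-1 * P y + K * P y ^+ 2.
have CQ : C2_on A Q by exact: jet2_C2 (jet2_quad 0 2^-1 K A_open JP).
have QY : Q Y = perron Y by rewrite /Q PY u0; ring.
have QM : \forall y \near Y, Q y <= perron y.
  have N : \forall y \near Y, `|P y| < (2 * K)^-1.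
    have k0 : 0 < (2 * K)^-1 by rewrite invr_gt0 mulr_gt0.
    have [r r0 rP] := (continuous_enP _ _).1 (C2_continuous A_open CP AY) _ k0.
    by apply/near_enP; exists r => // y /rP; rewrite PY u0 subr0.
  have NA : nbhs Y A by exact: open_nbhs_nbhs.
  apply: filterS2 PM (filterI N NA) => y Py [Ny /A_sub_closure /perron_ge0 uy].
  have {}Ny : `|K * P y| < 2^-1.
    rewrite normrM gtr0_norm//; have := Ny; rewrite -(ltr_pM2l K0) invfM mulrCA divff ?gt_eqF//.
    by rewrite mulr1.
  (* The bound on |P| places the second factor strictly between 0 and 1. *)
  have -> : Q y = P y * (2^-1 + K * P y) by rewrite /Q; ring.
  move/ltr_normlP: Ny => [? ?].
  have [P0|P0] := leP 0 (P y); last by apply: le_trans uy; rewrite nmulr_rle0//; lra.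
  by apply: le_trans Py; rewrite ler_piMr//; lra.
have := no_bump CQ AY QY QM ltr01; rewrite u0 add0r.
have -> : infinity_laplacian Q Y = 8^-1 * infinity_laplacian P Y + (absorption gamma 1 + 1).
  rewrite (laplacian_quad _ _ _ A_open JP AY) PY u0 -/g /K; field.
  by rewrite gt_eqF.
by rewrite LP; lra.
Qed.

Lemma perron_solution : dirichlet_solution gamma A phi perron.
Proof.
split; [exact: perron_continuous|exact: perron_ge0| |exact: perron_boundary].
by split; [exact: perron_subsolution|exact: perron_supersolution].
Qed.
End Perron.

Theorem theorem3p1 (R : realType) (n : nat) (gamma : R)
    (Omega : set 'rV[R]_n) (phi : 'rV[R]_n -> R)
    (hn : (2 <= n)%N) (hgamma0 : 0 <= gamma) (hgamma3 : gamma < 3)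
    (hOmega : bounded_domain Omega)
    (hphi : {within boundary Omega, continuous phi})
    (hphi0 : forall x, boundary Omega x -> 0 <= phi x) :
  (exists u : 'rV[R]_n -> R, dirichlet_solution gamma Omega phi u) /\
  (forall u v : 'rV[R]_n -> R,
     dirichlet_solution gamma Omega phi u ->
     dirichlet_solution gamma Omega phi v ->
     forall x, closure Omega x -> u x = v x).
Proof.
have [A0 oA _ bA] := hOmega.
split.
  exists (perron gamma Omega phi).
  exact: (perron_solution (ltnW hn) hgamma0 oA bA A0 hphi hphi0).
move=> u v [uc u0 [usub usup] ub] [vc v0 [vsub vsup] vb] x Kx.
apply/eqP; rewrite eq_le; apply/andP; split.
  apply: (dirichlet_comparison hgamma0 hgamma3 oA bA uc vc v0 usub vsup _ Kx).
  by move=> y By; rewrite ub// vb.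
apply: (dirichlet_comparison hgamma0 hgamma3 oA bA vc uc u0 vsub usup _ Kx).
by move=> y By; rewrite ub// vb.
Qed.
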